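(* Let $d>0$, let $W$ be a connected graphon with $\mathrm{mindeg}(W)\ge d$, and let $\sigma$ be a chip configuration on $W$ such that $(W,\sigma)$ is a smooth pair. Then for every $\varepsilon>0$ there exists $\delta>0$ such that whenever $W'$ is a connected graphon with $\mathrm{mindeg}(W')\ge d$ and $\mathrm{d}_\Box(W,W')<\delta$, and $\sigma'$ is a chip configuration with $\|\sigma-\sigma'\|_1<\delta$, we have $|a(W,\sigma)-a(W',\sigma')|<\varepsilon$.
   Context: A graphon is a Lebesgue measurable symmetric function $W:[0,1]^2\to[0,1]$; $\lambda$ is Lebesgue measure, $\deg_W(x)=\int_0^1W(x,y)\,dy$, and $\mathrm{mindeg}(W)$ is the essential infimum of $\deg_W$. $W$ is connected if there is no measurable partition $[0,1]=A\cup B$ with $\lambda(A),\lambda(B)>0$ and $W=0$ a.e. on $A\times B$. The cut distance is $\mathrm{d}_\Box(U,W)=\sup_{S,T\subseteq[0,1]}\left|\int_S\int_T (U(x,y)-W(x,y))\,dy\,dx\right|$ (over measurable $S,T$). A chip configuration is an a.e. non-negative $\sigma\in L^1([0,1])$. Firing vector: $f(W,\sigma)(x)=\lfloor\sigma(x)/\deg_W(x)\rfloor$ if $\deg_W(x)>0$, else $0$; update $U\sigma(x)=\sigma(x)-\deg_W(x)f(W,\sigma)(x)+\int_0^1 f(W,\sigma)(y)W(x,y)\,dy$, with iterates $U^n$; odometer $u_n(W,\sigma)(x)=\sum_{i=0}^{n-1}f(W,U^i\sigma)(x)$. The activity $a(W,\sigma)$ is the real number $a$ (when it exists) with $\lim_n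 u_n(W,\sigma)(x)/n=a$ for a.e. $x$; for connected graphons with positive minimal degree it always exists. $(W,\sigma)$ is a smooth pair if for every $n\in\mathbb{N}$, $\lambda(\{x: \exists k\in\mathbb{N}\ U^n\sigma(x)=k\deg_W(x)\})=0$. *)

(* Defs.v *)
From HB Require Import structures.
From mathcomp Require Import all_boot all_order all_algebra.
From mathcomp Require Import all_classical all_reals all_analysis.
From mathcomp Require Import measurable_realfun ess_sup_inf.

Set Implicit Arguments.
Unset Strict Implicit.
Unset Printing Implicit Defensive.

Import Order.TTheory GRing.Theory Num.Theory.
Import numFieldNormedType.Exports.

Local Open Scope classical_set_scope.
Local Open Scope ring_scope.

(* [lebesgue_measure] lives on the Borel sigma-algebra. Lebesgue measurability
   is measurability for its completion, whose sets are the B `|` N with B Borel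
   and N negligible ([completed_algebra_gen]); for the product measure on
   R * R this gives the two-dimensional Lebesgue sigma-algebra.
   On Lebesgue measurable data that is not Borel, [lebesgue_measure A] is by
   definition the outer measure of A, and the integral of a nonnegative
   function is a supremum over the simple functions below it, so both return
   the usual value. *)

Local Notation leb := (@lebesgue_measure _).
Local Notation leb2 := (@lebesgue_measure _ \x @lebesgue_measure _)%E.

Definition lebesgue_set {R : realType} (A : set R) : Prop :=
  completed_algebra_gen (@lebesgue_measure R) A.

Definition completed_measurable_fun (d : measure_display) (T : measurableType d)
    (R : realType) (mu : set T -> \bar R) (D : set T) (f : T -> R) : Prop :=
  forall Y : set R, measurable Y -> completed_algebra_gen mu (D `&` f @^-1` Y).

Definition unit_itv {R : realType} : set R := `[0, 1]%classic.

(* Functions on [0,1] and [0,1]^2 are total functions on R and R * R of which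
   only the values on [0,1] and [0,1]^2 are ever used. *)

Definition is_graphon {R : realType} (W : R -> R -> R) : Prop :=
  [/\ completed_measurable_fun leb2 (unit_itv `*` unit_itv)
        (fun z => W z.1 z.2),
      (forall x y, unit_itv x -> unit_itv y -> W x y = W y x) &
      (forall x y, unit_itv x -> unit_itv y -> 0 <= W x y <= 1)].

Definition deg {R : realType} (W : R -> R -> R) (x : R) : R :=
  \int[leb]_(y in unit_itv) W x y.

Definition mindeg {R : realType} (W : R -> R -> R) : \bar R :=
  ess_inf (mrestr (@lebesgue_measure R) (measurable_itv `[0, 1]))
    (fun x => (deg W x)%:E).

Definition graphon_connected {R : realType} (W : R -> R -> R) : Prop :=
  ~ exists A B : set R,
      [/\ lebesgue_set A, lebesgue_set B,
          A `|` B = unit_itv, A `&` B = set0 &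
          [/\ (0 < leb A)%E, (0 < leb B)%E &
              {ae leb2, forall z, (A `*` B) z -> W z.1 z.2 = 0}]].

Definition cut_dist {R : realType} (U W : R -> R -> R) : \bar R :=
  ereal_sup [set r : \bar R | exists S T : set R,
    [/\ lebesgue_set S, lebesgue_set T, S `<=` unit_itv, T `<=` unit_itv &
        r = `| \int[leb]_(x in S) \int[leb]_(y in T) (U x y - W x y)%:E |%E]].

Definition norm1 {R : realType} (f : R -> R) : \bar R :=
  (\int[leb]_(x in unit_itv) `|f x|%:E)%E.

Definition chip_configuration {R : realType} (sigma : R -> R) : Prop :=
  [/\ completed_measurable_fun leb unit_itv sigma,
      (norm1 sigma < +oo)%E &
      {ae leb, forall x, unit_itv x -> 0 <= sigma x}].

Definition firing {R : realType} (W : R -> R -> R) (sigma : R -> R) (x : R) : R :=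
  if 0 < deg W x then (Num.floor (sigma x / deg W x))%:~R else 0.

Definition update {R : realType} (W : R -> R -> R) (sigma : R -> R) (x : R) : R :=
  sigma x - deg W x * firing W sigma x
  + \int[leb]_(y in unit_itv) (firing W sigma y * W x y).

Definition odometer {R : realType} (W : R -> R -> R) (n : nat)
    (sigma : R -> R) (x : R) : R :=
  \sum_(i < n) firing W (iter i (update W) sigma) x.

Definition is_activity {R : realType} (W : R -> R -> R) (sigma : R -> R)
    (a : R) : Prop :=
  {ae leb, forall x, unit_itv x ->
     odometer W n sigma x / n%:R @[n --> \oo] --> a}.

(* The activity is unique when it exists; 0 is a default value. *)
Definition activity {R : realType} (W : R -> R -> R) (sigma : R -> R) : R :=
  xget 0 [set a | is_activity W sigma a].

Definition smooth_pair {R : realType} (W : R -> R -> R) (sigma : R -> R) : Prop :=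
  forall n : nat,
    leb.-negligible [set x | unit_itv x /\
      exists k : nat, iter n (update W) sigma x = k%:R * deg W x].

(* Main.v *)
Require Import Defs.
From HB Require Import structures.
From mathcomp Require Import all_boot all_order all_algebra.
From mathcomp Require Import all_classical all_reals all_analysis.
From mathcomp Require Import measurable_realfun ess_sup_inf.
From mathcomp Require Import ring lra.

(* Write T f(x) = \int f(y) W(x, y) dy and D = T 1. The odometer obeys
   u_(n+1) = floor ((sigma + T u_n) / D), a map of u_n that is monotone and
   commutes with integer constants. Hence, for bounded sigma, an integer bound
   u_n <= k gives u_(jn) <= jk, and likewise from below, so the activity lies
   between inf u_n / n and sup u_n / n for every n. An integrable sigma becomes
   bounded after one update.

   Existence: v_n = u_n / n satisfies D v_n - T v_n = O(1/n) uniformly. Along any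
   subsequence limsup v_n is subharmonic, hence a.e. constant by symmetry and
   connectedness, and bounds v_n from above up to o(1); the same holds for
   liminf. As L^1 is separable, some g has \int |W(x, .) - g| < eps for a
   non-negligible set of x; along a subsequence on which \int g v_n converges,
   v_n(x) oscillates by O(eps) for these x, so limsup and liminf almost agree and
   the oscillation of v_n over [0,1] tends to 0.

   Continuity: for a smooth pair the recursion is continuous in L^1, so for fixed
   n the odometers u_n and u'_n are L^1-close; one further step turns this into
   sup u'_(n+1) <= sup u_n + K with K independent of n, and dually, which traps
   a' near a once n is large.

   All of this is done for a Borel kernel with D >= d everywhere; a graphon is
   replaced by such a version, which changes nothing up to null sets. *)

Set Implicit Arguments.
Unset Strict Implicit.
Unset Printing Implicit Defensive.

Import Order.TTheory GRing.Theory Num.Theory.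
Import numFieldNormedType.Exports.

Local Open Scope classical_set_scope.
Local Open Scope ring_scope.

(** * Real-valued integration on a probability space *)

Section integrable_tools.
Context (d : measure_display) (T : measurableType d) (R : realType).
Variable P : probability T R.
Local Notation L1 f := (P.-integrable setT (EFin \o f)).
Implicit Types f g : T -> R.

Lemma L1_measurable f : L1 f -> measurable_fun setT f.
Proof. by move=> /integrableP[/measurable_EFinP]. Qed.

Lemma L1_le f g : measurable_fun setT f -> L1 g -> (forall x, `|f x| <= g x) ->
  L1 f.
Proof.
move=> mf Lg fg; apply: (le_integrable measurableT _ _ Lg).
  exact/measurable_EFinP.
by move=> x _ /=; rewrite lee_fin (le_trans (fg x))// ler_norm.
Qed.

Lemma L1_cst (c : R) : L1 (cst c).
Proof. exact: finite_measure_integrable_cst. Qed.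

Lemma L1_bounded f (C : R) : measurable_fun setT f -> (forall x, `|f x| <= C) ->
  L1 f.
Proof. by move=> mf fC; apply: (L1_le mf (L1_cst C)). Qed.

Lemma L1D f g : L1 f -> L1 g -> L1 (fun x => f x + g x).
Proof. by move=> Lf Lg; have := integrableD measurableT Lf Lg. Qed.

Lemma L1B f g : L1 f -> L1 g -> L1 (fun x => f x - g x).
Proof. by move=> Lf Lg; have := integrableB measurableT Lf Lg. Qed.

Lemma L1Z (c : R) f : L1 f -> L1 (fun x => c * f x).
Proof. by move=> Lf; have := integrableZl measurableT c Lf. Qed.

Lemma L1norm f : L1 f -> L1 (fun x => `|f x|).
Proof. by move=> Lf; have := integrable_norm Lf. Qed.

Lemma L1M f g : L1 f -> measurable_fun setT g -> (forall x, `|g x| <= 1) ->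
  L1 (fun x => f x * g x).
Proof.
move=> Lf mg g1; apply: L1_le (L1norm Lf) _.
  by apply: measurable_funM => //; exact: L1_measurable.
by move=> x; rewrite normrM ler_piMr.
Qed.

Lemma RintD f g : L1 f -> L1 g ->
  \int[P]_x (f x + g x) = \int[P]_x f x + \int[P]_x g x.
Proof. by move=> Lf Lg; rewrite RintegralD. Qed.

Lemma RintB f g : L1 f -> L1 g ->
  \int[P]_x (f x - g x) = \int[P]_x f x - \int[P]_x g x.
Proof. by move=> Lf Lg; rewrite RintegralB. Qed.

Lemma RintZ (c : R) f : L1 f -> \int[P]_x (c * f x) = c * \int[P]_x f x.
Proof. by move=> Lf; rewrite RintegralZl. Qed.

Lemma Rint_cst (c : R) : \int[P]_x (cst c x) = c.
Proof.
have P1 : P setT = 1%E by exact: probability_setT.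
by rewrite (Rintegral_cst P measurableT) [X in fine X]P1 mulr1.
Qed.

Lemma Rint_le f g : L1 f -> L1 g -> (forall x, f x <= g x) ->
  \int[P]_x f x <= \int[P]_x g x.
Proof. by move=> Lf Lg fg; apply: le_Rintegral. Qed.

Lemma Rint_ge0 f : (forall x, 0 <= f x) -> 0 <= \int[P]_x f x.
Proof. by move=> f0; apply: Rintegral_ge0. Qed.

Lemma Rint_norm f : L1 f -> `|\int[P]_x f x| <= \int[P]_x `|f x|.
Proof. by move=> Lf; apply: le_normr_Rintegral. Qed.

Lemma EFin_Rint f : L1 f -> (\int[P]_x f x)%:E = (\int[P]_x (f x)%:E)%E.
Proof. by move=> Lf; rewrite /Rintegral fineK//; apply: integrable_fin_num. Qed.

Lemma Rint_cvg (f_ : nat -> T -> R) f g :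
  (forall n, measurable_fun setT (f_ n)) -> measurable_fun setT f ->
  (forall x, f_ ^~ x @ \oo --> f x) -> L1 g ->
  (forall n x, `|f_ n x| <= g x) ->
  (\int[P]_x f_ n x) @[n --> \oo] --> \int[P]_x f x.
Proof.
move=> mf_ mf ff Lg fg.
have [Lf _ cv] := @dominated_convergence _ _ _ P setT measurableT
  (fun n => EFin \o f_ n) (EFin \o f) (EFin \o g)
  (fun n => proj2 (measurable_EFinP _ _) (mf_ n))
  (proj2 (measurable_EFinP _ _) mf)
  ltac:(by apply: aeW => x _; apply: cvg_EFin; [exact: nearW|exact: ff])
  Lg
  ltac:(by apply: aeW => x n _ /=; rewrite lee_fin).
rewrite /Rintegral; apply: fine_cvg.
rewrite fineK; last exact: integrable_fin_num.
exact: cv.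
Qed.

Lemma Rint_eq0_ae f : L1 f -> (forall x, 0 <= f x) -> \int[P]_x f x = 0 ->
  {ae P, forall x, f x = 0}.
Proof.
move=> Lf f0 If; have /ae_eq_integral_abs : measurable_fun setT (EFin \o f).
  exact/measurable_EFinP/L1_measurable.
move=> /(_ P measurableT)[H _].
have /H : (\int[P]_(x in setT) `|(EFin \o f) x| = 0)%E.
  transitivity (\int[P]_x (f x)%:E)%E.
    by apply: eq_integral => x _ /=; rewrite ger0_norm.
  by rewrite -EFin_Rint// If.
by apply: filterS => x /(_ Logic.I) [].
Qed.

(** Dominated convergence: the excess of [f] over [n] is bounded by [f] and is 0 once [n >= f x].
    Truncation makes integrable functions accessible to the cut norm. *)
Lemma L1_tail f : L1 f -> (forall x, 0 <= f x) -> forall eps, 0 < eps ->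
  exists K : nat, \int[P]_x (f x - Num.min (f x) K%:R) <= eps.
Proof.
move=> Lf f0 eps eps0.
have mf := L1_measurable Lf.
have : (\int[P]_x (f x - Num.min (f x) n%:R)) @[n --> \oo] --> \int[P]_x (cst 0 x).
  apply: (Rint_cvg _ _ _ Lf).
  - move=> n; apply: measurable_funB => //.
    by apply: measurable_minr => //.
  - exact: measurable_cst.
  - move=> x; apply/cvgrPdist_le => e e0; near=> n.
    have fn : f x <= n%:R by near: n; exact: nbhs_infty_ger.
    by rewrite min_l// subrr /= subr0 normr0 ltW.
  - move=> n x; rewrite ger0_norm ?subr_ge0 ?ge_min ?lexx//.
    by rewrite gerBl le_min f0 ler0n.
rewrite Rint_cst => /cvgrPdist_le /(_ _ eps0)[N _ /(_ N (leqnn _))].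
by rewrite /= sub0r normrN => h; exists N; apply: le_trans h; rewrite ler_norm.
Unshelve. all: by end_near. Qed.

Lemma L1_indic (A : set T) : measurable A -> L1 (\1_A : T -> R).
Proof.
move=> mA; apply: (@L1_bounded _ 1); first exact: measurable_indic.
by move=> x; rewrite indicE; case: (x \in A); rewrite ?normr1 ?normr0.
Qed.

Lemma measurable_natr_bool (b : T -> bool) : measurable [set x | b x] ->
  measurable_fun setT (fun x => (b x)%:R : R).
Proof.
move=> mb; rewrite (_ : (fun x => _) = \1_[set x | b x]).
  exact: measurable_indic.
apply/funext => x; rewrite indicE; congr (nat_of_bool _)%:R.
by apply/idP/idP; rewrite inE.
Qed.

End integrable_tools.

(** * Kernels on a probability space *)

Section kernel_definitions.
Context (disp : measure_display) (T : measurableType disp) (R : realType).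
Variable P : probability T R.

Definition kdeg (W : T -> T -> R) (x : T) : R := \int[P]_y W x y.

(* The operator T of the header. *)
Definition kop (W : T -> T -> R) (f : T -> R) (x : T) : R :=
  \int[P]_y (f y * W x y).

Definition degkernel (d : R) (W : T -> T -> R) : Prop :=
  [/\ measurable_fun setT (fun z : T * T => W z.1 z.2),
      (forall x y, W x y = W y x),
      (forall x y, 0 <= W x y <= 1) &
      (forall x, d <= kdeg W x)].

Definition kstep (W : T -> T -> R) (sigma u : T -> R) (x : T) : R :=
  (Num.floor ((sigma x + kop W u x) / kdeg W x))%:~R.

Definition kodo (W : T -> T -> R) (sigma : T -> R) (n : nat) : T -> R :=
  iter n (kstep W sigma) (cst 0).

End kernel_definitions.

Section kernel_theory.
Context (disp : measure_display) (T : measurableType disp) (R : realType).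
Variable P : probability T R.
Local Notation L1 f := (P.-integrable setT (EFin \o f)).
Variables (d : R) (W : T -> T -> R).
Hypothesis d0 : 0 < d.
Hypothesis kW : degkernel P d W.
Implicit Types f g : T -> R.

Let mW : measurable_fun setT (fun z : T * T => W z.1 z.2).
Proof. by case: kW. Qed.

Lemma kernel_sym x y : W x y = W y x. Proof. by case: kW. Qed.
Lemma kernel_ge0 x y : 0 <= W x y.
Proof. by case: kW => _ _ /(_ x y) /andP[]. Qed.
Lemma kernel_le1 x y : W x y <= 1.
Proof. by case: kW => _ _ /(_ x y) /andP[]. Qed.
Lemma kdeg_ge x : d <= kdeg P W x. Proof. by case: kW. Qed.
Lemma kdeg_gt0 x : 0 < kdeg P W x. Proof. exact: lt_le_trans (kdeg_ge x). Qed.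

Lemma kernel_norm x y : `|W x y| <= 1.
Proof. by rewrite ger0_norm ?kernel_le1// kernel_ge0. Qed.

Lemma kernel_section x : measurable_fun setT (W x).
Proof.
have -> : W x = (fun z : T * T => W z.1 z.2) \o pair x by [].
by apply: measurableT_comp.
Qed.

Lemma kernel_L1 x : L1 (W x).
Proof. exact: (L1_bounded _ (kernel_section x) (kernel_norm x)). Qed.

Lemma kdeg_le1 x : kdeg P W x <= 1.
Proof.
rewrite -(Rint_cst P 1); apply: Rint_le (kernel_L1 x) (L1_cst _ _) _ => y.
exact: kernel_le1.
Qed.

Lemma kopL1 f x : L1 f -> L1 (fun y => f y * W x y).
Proof. by move=> Lf; apply: L1M => //; [exact: kernel_section|exact: kernel_norm]. Qed.

Lemma kop_ge0 f x : (forall y, 0 <= f y) -> 0 <= kop P W f x.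
Proof. by move=> f0; apply: Rint_ge0 => y; rewrite mulr_ge0// kernel_ge0. Qed.

Lemma kop_le f g x : L1 f -> L1 g -> (forall y, f y <= g y) ->
  kop P W f x <= kop P W g x.
Proof.
move=> Lf Lg fg; apply: Rint_le; [exact: kopL1|exact: kopL1|] => y.
by rewrite ler_wpM2r// kernel_ge0.
Qed.

Lemma kopD f g x : L1 f -> L1 g ->
  kop P W (fun y => f y + g y) x = kop P W f x + kop P W g x.
Proof.
move=> Lf Lg; rewrite /kop -RintD; [|exact: kopL1..].
by apply: eq_Rintegral => y _; rewrite mulrDl.
Qed.

Lemma kopB f g x : L1 f -> L1 g ->
  kop P W (fun y => f y - g y) x = kop P W f x - kop P W g x.
Proof.
move=> Lf Lg; rewrite /kop -RintB; [|exact: kopL1..].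
by apply: eq_Rintegral => y _; rewrite mulrBl.
Qed.

Lemma kopZ c f x : L1 f -> kop P W (fun y => c * f y) x = c * kop P W f x.
Proof.
move=> Lf; rewrite /kop -RintZ; [|exact: kopL1..].
by apply: eq_Rintegral => y _; rewrite mulrA.
Qed.

Lemma kop_cst c x : kop P W (cst c) x = c * kdeg P W x.
Proof. by rewrite /kop /kdeg -RintZ//; exact: kernel_L1. Qed.

Lemma kop_norm f x : L1 f -> `|kop P W f x| <= \int[P]_y `|f y|.
Proof.
move=> Lf; apply: (le_trans (Rint_norm (kopL1 x Lf))).
apply: Rint_le; [exact/L1norm/kopL1|exact: L1norm|] => y.
by rewrite normrM ler_piMr// kernel_norm.
Qed.

Lemma kop_le_int f x : L1 f -> (forall y, 0 <= f y) -> kop P W f x <= \int[P]_y f y.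
Proof.
move=> Lf f0; apply: Rint_le => //; first exact: kopL1.
by move=> y; rewrite ler_piMr// kernel_le1.
Qed.

Let mfW f : measurable_fun setT f ->
  measurable_fun setT (fun z : T * T => (f z.2 * W z.1 z.2)%:E).
Proof.
move=> mf; apply/measurable_EFinP/measurable_funM => //.
exact: (measurableT_comp mf).
Qed.

Lemma EFin_kop f x : L1 f -> (kop P W f x)%:E = (\int[P]_y (f y * W x y)%:E)%E.
Proof. by move=> Lf; rewrite /kop EFin_Rint//; exact: kopL1. Qed.

Lemma measurable_kop f : L1 f -> (forall x, 0 <= f x) ->
  measurable_fun setT (kop P W f).
Proof.
move=> Lf f0; apply/measurable_EFinP.
rewrite [X in measurable_fun _ X](_ : _ =
   fubini_F P (fun z : T * T => (f z.2 * W z.1 z.2)%:E)); last first.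
  by apply/funext => x /=; rewrite EFin_kop.
apply: measurable_fun_fubini_tonelli_F; first exact: mfW (L1_measurable Lf).
by move=> z; rewrite lee_fin mulr_ge0// kernel_ge0.
Qed.

Lemma measurable_kdeg : measurable_fun setT (kdeg P W).
Proof.
have -> : kdeg P W = kop P W (cst 1).
  by apply/funext => x; rewrite kop_cst mul1r.
by apply: measurable_kop; [exact: L1_cst|move=> x /=].
Qed.

Lemma kop_L1 f : L1 f -> (forall x, 0 <= f x) -> L1 (kop P W f).
Proof.
move=> Lf f0; apply: (@L1_bounded _ _ _ _ _ (\int[P]_y f y)).
  exact: measurable_kop.
by move=> x; rewrite ger0_norm ?kop_ge0// kop_le_int.
Qed.

Lemma kdegM_L1 f : L1 f -> L1 (fun x => f x * kdeg P W x).
Proof.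
move=> Lf; apply: L1M => //; first exact: measurable_kdeg.
by move=> x; rewrite ger0_norm ?kdeg_le1// ltW// kdeg_gt0.
Qed.

(** Tonelli and the symmetry of [W]: the operator is self-adjoint and sends 1 to the degree. *)
Lemma kop_int f : L1 f -> (forall x, 0 <= f x) ->
  \int[P]_x kop P W f x = \int[P]_x (f x * kdeg P W x).
Proof.
move=> Lf f0; apply: EFin_inj.
rewrite EFin_Rint; last exact: kop_L1.
rewrite EFin_Rint; last exact: kdegM_L1.
transitivity (\int[P]_x \int[P]_y (f y * W x y)%:E)%E.
  by apply: eq_integral => x _; rewrite EFin_kop.
rewrite (@fubini_tonelli _ _ _ _ _ P P
  (fun z : T * T => (f z.2 * W z.1 z.2)%:E)) /=; last 2 first.
- exact: mfW (L1_measurable Lf).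
- by move=> z; rewrite lee_fin mulr_ge0// kernel_ge0.
apply: eq_integral => y _.
transitivity (\int[P]_x (f y * W y x)%:E)%E.
  by apply: eq_integral => x _; rewrite kernel_sym.
rewrite -EFin_Rint; last exact/L1Z/kernel_L1.
by rewrite RintZ//; exact: kernel_L1.
Qed.

End kernel_theory.

(** * The odometer as an orbit of a monotone map *)

Section parallel_odometer.
Context (disp : measure_display) (T : measurableType disp) (R : realType).
Variable P : probability T R.
Local Notation L1 f := (P.-integrable setT (EFin \o f)).
Variables (d : R) (W : T -> T -> R).
Hypothesis d0 : 0 < d.
Hypothesis kW : degkernel P d W.
Variable sigma : T -> R.
Hypothesis L1sigma : L1 sigma.
Hypothesis sigma_ge0 : forall x, 0 <= sigma x.
Implicit Types u v : T -> R.
Local Notation D := (kdeg P W).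
Local Notation step := (kstep P W sigma).
Local Notation u_ := (kodo P W sigma).

Let D0 x : 0 < D x. Proof. exact: (kdeg_gt0 d0 kW). Qed.

Lemma measurable_div_kdeg (h : T -> R) : measurable_fun setT h ->
  measurable_fun setT (fun x => h x / D x).
Proof.
move=> mh; apply: measurable_funM => //.
(* As [D x >= d], the inverse factors through [t |-> 1 / max(t, d)], which is monotone on the whole
   line. *)
rewrite (_ : (fun x => (D x)^-1) = (fun t : R => (Num.max t d)^-1) \o D).
  apply: measurableT_comp; last exact: (measurable_kdeg kW).
  apply: nonincreasing_measurable => // s t st.
  by rewrite lef_pV2 ?posrE ?lt_max ?d0 ?orbT// ge_max !le_max st lexx orbT.
by apply/funext => x /=; rewrite max_l// (kdeg_ge kW).
Qed.

Lemma measurable_floor (h : T -> R) : measurable_fun setT h ->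
  measurable_fun setT (fun x => (Num.floor (h x))%:~R : R).
Proof.
move=> mh; apply: (@measurableT_comp _ _ _ _ _ _ (fun t : R => (Num.floor t)%:~R : R)) => //.
apply: nondecreasing_measurable => // s t st.
by rewrite ler_int le_floor.
Qed.

Lemma kstep_le u x : step u x <= (sigma x + kop P W u x) / D x.
Proof. exact: floor_le. Qed.

Lemma kstep_gt u x : (sigma x + kop P W u x) / D x - 1 < step u x.
Proof. by rewrite ltrBlDr -intrD1 floorD1_gt. Qed.

Lemma kstep_ge0 u x : (forall y, 0 <= u y) -> 0 <= step u x.
Proof.
move=> u0; rewrite ler0z floor_ge0 divr_ge0//; last exact: ltW.
by rewrite addr_ge0// (kop_ge0 kW).
Qed.

Lemma kstep_L1 u : L1 u -> (forall y, 0 <= u y) -> L1 (step u).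
Proof.
move=> Lu u0; apply: (@L1_le _ _ _ _ _ (fun x => d^-1 * (sigma x + kop P W u x))).
- apply: measurable_floor; apply: measurable_div_kdeg.
  apply: measurable_funD; first exact: L1_measurable L1sigma.
  exact: (measurable_kop kW).
- by apply: L1Z; apply: L1D => //; exact: (kop_L1 kW).
- move=> x; rewrite ger0_norm ?kstep_ge0// (le_trans (kstep_le _ _))//.
  rewrite mulrC ler_wpM2r ?addr_ge0 ?(kop_ge0 kW)//.
  by rewrite lef_pV2 ?posrE// (kdeg_ge kW).
Qed.

Lemma kstep_mono u v x : L1 u -> L1 v -> (forall y, u y <= v y) ->
  step u x <= step v x.
Proof.
move=> Lu Lv uv; rewrite ler_int le_floor// ler_pM2r ?invr_gt0//.
by rewrite lerD2l (kop_le kW).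
Qed.

(** The operator sends the constant [c] to [c * D x], so the quotient moves by exactly [c], and an
    integer passes through the floor. *)
Lemma kstep_addz u (c : R) x : L1 u -> c \is a Num.int ->
  step (fun y => u y + c) x = step u x + c.
Proof.
move=> Lu cz; rewrite /kstep.
rewrite (kopD kW _ Lu (L1_cst P c)) (kop_cst kW) addrA mulrDl mulfK ?gt_eqF//.
by rewrite floorDrz// intrD (floorK cz).
Qed.

Lemma kodo_ge0 n x : 0 <= u_ n x.
Proof. by elim: n x => [//|n IH] x; rewrite /kodo iterS kstep_ge0. Qed.

Lemma kodo_L1 n : L1 (u_ n).
Proof.
elim: n => [|n IH]; first exact: L1_cst.
by rewrite /kodo iterS; apply: kstep_L1 => // x; apply: kodo_ge0.
Qed.

Lemma kodo_int n x : u_ n x \is a Num.int.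
Proof. by case: n => [|n]; rewrite /kodo ?iterS //= ?rpred0 // intr_int. Qed.

Lemma kodo_mono n x : u_ n x <= u_ n.+1 x.
Proof.
elim: n x => [|n IH] x; first exact: kodo_ge0.
by rewrite /kodo !iterS;
  apply: kstep_mono; [exact: (kodo_L1 n)|exact: (kodo_L1 n.+1)|exact: IH].
Qed.

(** The case [m = 0] is the hypothesis; each further step keeps the inequality since [step] is
    monotone and commutes with adding [c]. *)
Lemma kodo_addl_le n (c : R) : c \is a Num.int -> (forall x, u_ n x <= c) ->
  forall m x, u_ (m + n) x <= u_ m x + c.
Proof.
move=> cz uc; elim=> [|m IH] x; first by rewrite add0r.
rewrite addSn /kodo !iterS -kstep_addz//; last exact: (kodo_L1 m).
apply: kstep_mono; [exact: (kodo_L1 (m + n))| |exact: IH].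
by apply: L1D; [exact: (kodo_L1 m)|exact: L1_cst].
Qed.

Lemma kodo_addl_ge n (c : R) : c \is a Num.int -> (forall x, c <= u_ n x) ->
  forall m x, u_ m x + c <= u_ (m + n) x.
Proof.
move=> cz uc; elim=> [|m IH] x; first by rewrite add0r.
rewrite addSn /kodo !iterS -kstep_addz//; last exact: (kodo_L1 m).
apply: kstep_mono; [|exact: (kodo_L1 (m + n))|exact: IH].
by apply: L1D; [exact: (kodo_L1 m)|exact: L1_cst].
Qed.

Lemma kodo_mul_le n (c : R) : c \is a Num.int -> (forall x, u_ n x <= c) ->
  forall m x, u_ (m * n) x <= m%:R * c.
Proof.
move=> cz uc; elim=> [|m IH] x; first by rewrite mul0r mul0n.
rewrite mulSnr (le_trans (kodo_addl_le cz uc _ _))//.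
by rewrite -natr1 mulrDl mul1r lerD2r.
Qed.

Lemma kodo_mul_ge n (c : R) : c \is a Num.int -> (forall x, c <= u_ n x) ->
  forall m x, m%:R * c <= u_ (m * n) x.
Proof.
move=> cz uc; elim=> [|m IH] x; first by rewrite mul0r mul0n.
rewrite mulSnr (le_trans _ (kodo_addl_ge cz uc _ _))//.
by rewrite -natr1 mulrDl mul1r lerD2r.
Qed.

(* [sigma + T u_n - D u_n] is the configuration after n parallel updates. *)
Lemma kodo_config_ge0 n x : 0 <= sigma x + kop P W (u_ n) x - D x * u_ n x.
Proof.
case: n => [|n]; rewrite subr_ge0.
  by rewrite mulr0 addr_ge0// (kop_ge0 kW).
rewrite /kodo [in X in X <= _]iterS -/(u_ n) mulrC -ler_pdivlMr//.
rewrite (le_trans (kstep_le _ _))// ler_pM2r ?invr_gt0// lerD2l.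
by apply: (kop_le kW); [exact: (kodo_L1 n)|exact: (kodo_L1 n.+1)|exact: (kodo_mono n)].
Qed.

(** A point keeps at most [D x] of the chips it held when firing; the rest of its pile arrived
    during that step. *)
Lemma kodo_config_le n x : sigma x + kop P W (u_ n.+1) x - D x * u_ n.+1 x <=
  D x + (kop P W (u_ n.+1) x - kop P W (u_ n) x).
Proof.
have := kstep_gt (u_ n) x; rewrite -[step _ x]/(u_ n.+1 x).
rewrite ltrBlDr ltr_pdivrMr// => h; nra.
Qed.

Lemma kodo_int_ub (C : R) n : (forall x, u_ n x <= C) ->
  forall x, u_ n x <= (Num.floor C)%:~R.
Proof.
move=> uC x; rewrite -(floorK (kodo_int n x)) ler_int.
by apply: le_floor; exact: uC.
Qed.

(* The configuration after one update: bounded even if sigma is not. *)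
Definition kconfig1 x := sigma x + kop P W (u_ 1) x - D x * u_ 1 x.

Lemma kconfig1_ge0 x : 0 <= kconfig1 x. Proof. exact: kodo_config_ge0. Qed.

Lemma kconfig1_L1 : L1 kconfig1.
Proof.
apply: L1B; first by apply: L1D => //; apply: (kop_L1 kW);
  [exact: kodo_L1|exact: kodo_ge0].
rewrite (_ : (fun x => D x * u_ 1 x) = (fun x => u_ 1 x * D x)).
  by apply: (kdegM_L1 d0 kW); exact: kodo_L1.
by apply/funext => x; rewrite mulrC.
Qed.

(** At most [D x <= 1] survives the first firing, and at most the integral of [u_ 1 <= sigma / d]
    arrives. *)
Lemma kconfig1_le x : kconfig1 x <= 1 + (\int[P]_x sigma x) / d.
Proof.
apply: (le_trans (kodo_config_le 0 x)).
have -> : kop P W (u_ 0) x = 0 by rewrite (kop_cst kW) mul0r.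
rewrite subr0 lerD ?(kdeg_le1 kW)//.
apply: (le_trans (kop_le_int kW _ (kodo_L1 1) (kodo_ge0 1))).
rewrite mulrC -RintZ//; apply: Rint_le; [exact: kodo_L1|exact: L1Z|] => y.
rewrite (le_trans (kstep_le _ _))// (kop_cst kW) mul0r addr0 mulrC.
by rewrite ler_wpM2r// lef_pV2 ?posrE// (kdeg_ge kW).
Qed.

End parallel_odometer.

(** The chips moved by the first update are absorbed into [kconfig1]; what is left is the integer
    [kodo P W sigma 1 x], which passes through the floor. This trades an integrable configuration
    for a bounded one. *)
Lemma kodo_shift (disp : measure_display) (T : measurableType disp)
    (R : realType) (P : probability T R) (d : R) (W : T -> T -> R)
    (sigma : T -> R) :
  0 < d -> degkernel P d W -> P.-integrable setT (EFin \o sigma) ->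
  (forall x, 0 <= sigma x) -> forall n x,
  kodo P W sigma n.+1 x =
  kodo P W sigma 1 x + kodo P W (kconfig1 P W sigma) n x.
Proof.
move=> d0 kW Ls s0; elim=> [|n IH] x; first by rewrite addr0.
have Lt := kodo_L1 d0 kW (kconfig1_L1 d0 kW Ls s0) (kconfig1_ge0 d0 kW Ls s0).
have L1u := kodo_L1 d0 kW Ls s0.
have E s k : kodo P W s k.+1 x = kstep P W s (kodo P W s k) x by [].
rewrite (E sigma n.+1) (E (kconfig1 P W sigma)) addrC /kstep.
have -> : kop P W (kodo P W sigma n.+1) x =
    kop P W (kodo P W sigma 1) x + kop P W (kodo P W (kconfig1 P W sigma) n) x.
  by rewrite -(kopD kW)//; apply: eq_Rintegral => y _; rewrite IH.
have uz := kodo_int P W sigma 1 x.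
rewrite -[X in _ = _ + X](floorK uz) -intrD -floorDrz//; congr (Num.floor _)%:~R.
have D0 := kdeg_gt0 d0 kW x.
rewrite -[X in _ = _ + X](@mulfK _ (kdeg P W x)) ?gt_eqF// -mulrDl; congr (_ / _).
rewrite /kconfig1; lra.
Qed.

(** * Existence of the activity *)

Section ae_integral.
Context (disp : measure_display) (T : measurableType disp) (R : realType).
Variable P : probability T R.
Local Notation L1 f := (P.-integrable setT (EFin \o f)).

Lemma Rint_ae_eq (f g : T -> R) : L1 f -> L1 g -> {ae P, forall x, f x = g x} ->
  \int[P]_x f x = \int[P]_x g x.
Proof.
move=> Lf Lg fg; rewrite /Rintegral; congr fine; apply: ae_eq_integral => //.
- by apply/measurable_EFinP; exact: L1_measurable Lf.
- by apply/measurable_EFinP; exact: L1_measurable Lg.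
- by apply: filterS fg => x /= -> _.
Qed.

Lemma ae_of_measure0 (A : set T) : measurable A -> P A = 0%E ->
  {ae P, forall x, ~ A x}.
Proof. by move=> mA A0; exists A; split => // x /= /contrapT. Qed.

End ae_integral.

(** * Subharmonic functions on a connected kernel *)

Section connected_kernel.
Context (disp : measure_display) (T : measurableType disp) (R : realType).
Variable P : probability T R.
Local Notation L1 f := (P.-integrable setT (EFin \o f)).

(** Connectedness with an iterated null set in place of a product one: this is the form in which
    [kop P W g x = 0] with [g >= 0] yields vanishing edges. *)
Definition kconnected (W : T -> T -> R) : Prop := forall A : set T, measurable A ->
  {ae P, forall x, ~ A x -> {ae P, forall y, A y -> W x y = 0}} ->
  P A = 0%E \/ P (~` A) = 0%E.

(** A consequence of the separability of L^1: one ball around a bounded [g] catches the sections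
    [W x] for more than a null set of [x]. Negligibility makes sense for arbitrary sets. *)
Definition kseparable (W : T -> T -> R) : Prop := forall eps : R, 0 < eps ->
  exists g : T -> R, [/\ measurable_fun setT g,
    exists C : R, forall x, `|g x| <= C &
    ~ P.-negligible [set x | \int[P]_y `|W x y - g y| <= eps]].

Variables (d : R) (W : T -> T -> R).
Hypothesis d0 : 0 < d.
Hypothesis kW : degkernel P d W.
Hypothesis cW : kconnected W.
Local Notation D := (kdeg P W).

(* The positive part of [V - c] is again subharmonic, and its defect integrates
   to 0 by symmetry of W; hence no edges join [V > c] to its complement. *)
Lemma subharmonic_ae_cst (V : T -> R) (B : R) : measurable_fun setT V ->
  (forall x, `|V x| <= B) -> (forall x, D x * V x <= kop P W V x) ->
  {ae P, forall x, V x = \int[P]_x V x}.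
Proof.
move=> mV VB sV; set c := \int[P]_x V x.
have LV := L1_bounded P mV VB.
have LVc : L1 (fun x => V x - c) by apply: L1B => //; exact: L1_cst.
(* As [c] is the mean of [V], the positive part [g] and the negative part [g'] of [V - c] have the
   same integral, so it suffices that one of them vanishes a.e. *)
pose g x := Num.max (V x - c) 0; pose g' x := Num.max (c - V x) 0.
have Lg : L1 g.
  apply: L1_le (L1norm LVc) _.
    by apply: measurable_maxr => //; exact: L1_measurable LVc.
  move=> x; rewrite ger0_norm /g ?le_max ?lexx ?orbT//.
  by rewrite ge_max normr_ge0 ler_norm.
have g0 x : 0 <= g x by rewrite /g le_max lexx orbT.
have g'E x : g' x = g x - (V x - c).
  by rewrite /g /g'; case: (leP (V x - c) 0) => h1; case: (leP (c - V x) 0) => h2; lra.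
have Lg' : L1 g'.
  rewrite (_ : g' = fun x => g x - (V x - c)); last exact/funext.
  exact: L1B.
have gg' : \int[P]_x g' x = \int[P]_x g x.
  under eq_Rintegral do rewrite g'E.
  by rewrite RintB// RintB ?Rint_cst ?subrr ?subr0//; exact: L1_cst.
have sg x : g x * D x <= kop P W g x.
  have D0 : 0 < D x by exact: (kdeg_gt0 d0 kW).
  rewrite /g; case: (leP (V x - c) 0) => h; first by rewrite mul0r (kop_ge0 kW).
  apply: (@le_trans _ _ (kop P W (fun y => V y - c) x)); last first.
    by apply: (kop_le kW) => // y; rewrite /g le_max lexx.
  rewrite (kopB kW _ LV (L1_cst P c)) (kop_cst kW).
  by rewrite mulrBl lerB// mulrC.
have Lk : L1 (fun x => kop P W g x - g x * D x).
  by apply: L1B; [exact: (kop_L1 kW)|exact: (kdegM_L1 d0 kW)].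
have defect0 : {ae P, forall x, kop P W g x - g x * D x = 0}.
  apply: Rint_eq0_ae => //; first by move=> x; rewrite subr_ge0.
  rewrite RintB; [|exact: (kop_L1 kW)|exact: (kdegM_L1 d0 kW)].
  by rewrite (kop_int d0 kW)// subrr.
pose A := [set x | c < V x].
have mA : measurable A.
  rewrite /A -[X in measurable X]setTI.
  by apply: (measurable_fun_ltr (measurable_cst c) mV measurableT) => //.
have Ag x : A x -> 0 < g x by move=> Ax; rewrite /g lt_max subr_gt0 Ax.
have nAg x : ~ A x -> g x = 0.
  by move=> /negP; rewrite -leNgt => h; rewrite /g max_r// subr_le0.
have Ag' x : A x -> g' x = 0.
  by rewrite /A /= => h; rewrite /g' max_r// subr_le0 ltW.
have int0 : \int[P]_x g x = 0.
  have L0 := L1_cst P (0 : R).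
  have [|PA|PA] := cW mA.
  - apply: filterS defect0 => x h nAx.
    have k0 : kop P W g x = 0 by move: h; rewrite nAg// mul0r subr0.
    have := Rint_eq0_ae (kopL1 kW x Lg) _ k0.
    have H y : 0 <= g y * W x y by rewrite mulr_ge0// (kernel_ge0 kW).
    move=> /(_ H); apply: filterS => y /eqP.
    rewrite mulf_eq0 => /orP[/eqP gy0 /Ag|/eqP //].
    by rewrite gy0 ltxx.
  - rewrite (Rint_ae_eq Lg L0) ?Rint_cst//.
    by apply: filterS (ae_of_measure0 mA PA) => x /nAg.
  - rewrite -gg' (Rint_ae_eq Lg' L0) ?Rint_cst//.
    apply: filterS (ae_of_measure0 (measurableC mA) PA) => x.
    by move=> /contrapT /Ag'.
have ag := Rint_eq0_ae Lg g0 int0.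
have ag' : {ae P, forall x, g' x = 0}.
  apply: Rint_eq0_ae => //; last by rewrite gg'.
  by move=> x; rewrite /g' le_max lexx orbT.
apply: filterS2 ag ag' => x gx g'x.
by move: (g'E x); rewrite gx g'x; lra.
Qed.

(** [V] is the pointwise limsup, the limit of the decreasing tail suprema [s N]; the inequality
    survives dominated convergence, so [V] is a.e. a constant [c]. The upper bound is uniform in [x]
    because the operator turns the L^1 error of [s N] into a pointwise one. *)
Lemma subharmonic_limsup (v : nat -> T -> R) (e : nat -> R) (B : R) :
  (forall k, measurable_fun setT (v k)) ->
  (forall k x, 0 <= v k x <= B) -> e @ \oo --> 0 ->
  (forall k x, D x * v k x <= kop P W (v k) x + e k) ->
  exists c : R,
    {ae P, forall x, forall eps, 0 < eps -> forall N, exists2 k, (N <= k)%N &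
      c - eps <= v k x} /\
    (forall eps, 0 < eps -> exists N, forall k x, (N <= k)%N -> v k x <= c + eps).
Proof.
move=> mv vB e0 sv.
pose s N x := sups (v ^~ x) N; pose V x := inf (range (sups (v ^~ x))).
have ubv x : has_ubound (range (v ^~ x)).
  by exists B => _ [k _ <-]; case/andP: (vB k x).
have lbv x : has_lbound (range (v ^~ x)).
  by exists 0 => _ [k _ <-]; case/andP: (vB k x).
have scv x : s ^~ x @ \oo --> V x by exact: cvg_sups_inf.
have ms N : measurable_fun setT (s N) by apply: measurable_fun_sups.
have mV : measurable_fun setT V.
  by apply: (measurable_fun_cvg ms) => x _; exact: scv.
have vs N k x : (N <= k)%N -> v k x <= s N x.
  by move=> Nk; apply: ub_le_sup; [exact: has_ubound_sdrop|exists k].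
have s_ub N x (M : R) : (forall k, (N <= k)%N -> v k x <= M) -> s N x <= M.
  move=> vM; apply: ge_sup; first by exists (v N x); exists N => /=.
  by move=> _ [k /= Nk <-]; exact: vM.
have s0 N x : 0 <= s N x.
  by apply: le_trans (vs N N x (leqnn N)); case/andP: (vB N x).
have sB N x : s N x <= B.
  by apply: s_ub => k _; case/andP: (vB k x).
have nsB N x : `|s N x| <= B by rewrite ger0_norm.
have VN N x : V x <= s N x.
  apply: ge_inf; last by exists N.
  by exists 0 => _ [k _ <-]; exact: s0.
have V0 x : 0 <= V x.
  apply: lb_le_inf; first by exists (s 0%N x); exists 0%N.
  by move=> _ [k _ <-]; exact: s0.
have nVB x : `|V x| <= B by rewrite ger0_norm// (le_trans (VN 0%N x)).
have Lv k : L1 (v k).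
  apply: (@L1_bounded _ _ _ P _ B (mv k)) => x.
  by case/andP: (vB k x) => h1 h2; rewrite ger0_norm.
have Ls N : L1 (s N) by exact: L1_bounded (ms N) (nsB N).
have LV : L1 V by exact: L1_bounded mV nVB.
have D0 x : 0 < D x by exact: (kdeg_gt0 d0 kW).
have e_small eta : 0 < eta -> exists N, forall k, (N <= k)%N -> e k <= eta.
  move=> eta0; move/cvgrPdist_le : e0 => /(_ _ eta0)[N _ HN].
  exists N => k Nk; have := HN k Nk; rewrite sub0r normrN.
  by apply: le_trans; exact: ler_norm.
have vks N k x : (N <= k)%N -> D x * v k x <= kop P W (s N) x + e k.
  move=> Nk; rewrite (le_trans (sv k x))// lerD2r.
  by apply: (kop_le kW) => // y; exact: vs.
have sV x : D x * V x <= kop P W V x.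
  apply/ler_addgt0Pr => eta eta0.
  have [N HN] := e_small _ eta0.
  have H M : (N <= M)%N -> D x * V x <= kop P W (s M) x + eta.
    move=> NM; rewrite mulrC -ler_pdivlMr// (le_trans (VN M x))//.
    apply: s_ub => k Mk; rewrite ler_pdivlMr// mulrC (le_trans (vks M k x Mk))//.
    by rewrite lerD2l HN// (leq_trans NM).
  have cv : kop P W (s M) x @[M --> \oo] --> kop P W V x.
    apply: (Rint_cvg _ _ _ (L1_cst P B)).
    - move=> M; apply: measurable_funM => //; exact: (kernel_section kW).
    - apply: measurable_funM => //; exact: (kernel_section kW).
    - by move=> y; apply: cvgMl; exact: scv.
    - move=> M y; rewrite normrM -[leRHS]mulr1; apply: ler_pM => //.
      exact: (kernel_norm kW).
  rewrite -lerBlDr; apply: (cvgr_to_ge cv); exists N => // M NM /=.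
  by rewrite lerBlDr; exact: H.
have Vc := subharmonic_ae_cst mV nVB sV.
set c := \int[P]_x V x in Vc.
exists c; split.
  apply: filterS Vc => x Vxc eps eps0 N.
  have : s N x - eps < s N x by rewrite ltrBlDr ltrDl.
  move=> /(sup_gt _) [|_ [k /= Nk <-] h]; first by exists (v N x); exists N => /=.
  exists k => //; rewrite -Vxc (le_trans _ (ltW h))// lerB//; exact: VN.
move=> eps eps0.
have kV x : kop P W V x = c * D x.
  rewrite -(kop_cst kW) /kop; apply: Rint_ae_eq; [exact: (kopL1 kW)| |].
    by apply: (kopL1 kW); exact: L1_cst.
  by apply: filterS Vc => y ->.
(* The errors [e k] and [\int s N - c] may each use half of [eps * d], and
   [eps * d <= eps * D x]. *)
have h0 : 0 < eps * d / 2 by rewrite divr_gt0// mulr_gt0.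
have [N1 HN1] := e_small _ h0.
have cvs : \int[P]_x s M x @[M --> \oo] --> c.
  by apply: (Rint_cvg ms mV scv (L1_cst P B)).
move/cvgrPdist_le : cvs => /(_ _ h0)[N2 _ HN2].
pose N := maxn N1 N2; exists N => k x Nk.
have := vks N k x Nk; have := HN1 k (leq_trans (leq_maxl _ _) Nk).
have := HN2 N (leq_maxr _ _); rewrite /= distrC => /(le_trans (ler_norm _)).
have : kop P W (s N) x - kop P W V x <= \int[P]_x s N x - c.
  rewrite -(kopB kW) // -RintB//; apply: (kop_le_int kW); first exact: L1B.
  by move=> y; rewrite subr_ge0 VN.
rewrite kV => h1 h2 h3 h4.
have : D x * v k x <= D x * (c + eps).
  have : eps * d <= eps * D x by rewrite ler_pM2l// (kdeg_ge kW).
  by move=> h5; lra.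
by rewrite ler_pM2l.
Qed.

End connected_kernel.

(** * Vanishing oscillation and existence of the limit *)

Section activity_exists.
Context (disp : measure_display) (T : measurableType disp) (R : realType).
Variable P : probability T R.
Local Notation L1 f := (P.-integrable setT (EFin \o f)).
Variables (d : R) (W : T -> T -> R).
Hypothesis d0 : 0 < d.
Hypothesis kW : degkernel P d W.
Hypothesis cW : kconnected P W.
Hypothesis sW : kseparable P W.
Local Notation D := (kdeg P W).

Lemma kdeg_lb_le1 : d <= 1.
Proof. exact: le_trans (kdeg_ge kW point) (kdeg_le1 kW point). Qed.

(** By contradiction, along times where the oscillation exceeds [eps]. Applied to [w] and to
    [B - w], [subharmonic_limsup] gives an a.e. limsup [c] and liminf [B - c'], with uniform bounds
    from above and below; a gap of at most [eps / 2] between them contradicts the choice of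
    times. *)
Lemma almost_harmonic_osc (v : nat -> T -> R) (e : nat -> R) (B : R) :
  (forall k, measurable_fun setT (v k)) ->
  (forall k x, 0 <= v k x <= B) -> e @ \oo --> 0 ->
  (forall k x, `|D x * v k x - kop P W (v k) x| <= e k) ->
  forall eps, 0 < eps ->
  exists N, forall k x y, (N <= k)%N -> v k x - v k y <= eps.
Proof.
move=> mv vB e0 hv eps eps0; apply: contrapT => nosc.
have B0 : 0 <= B by case/andP: (vB 0%N point) => /le_trans; apply.
(* The final estimate is [d * (eps / 2 - 2 * r) < (B + 3) * r], which fails for this [r] because
   [d <= 1]. *)
pose r := eps * d / (2 * (B + 6)).
have r0 : 0 < r by rewrite divr_gt0 ?mulr_gt0// ltr_wpDl.
have rE : (B + 6) * r = eps * d / 2.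
  by rewrite /r; field; rewrite gt_eqF// ltr_wpDl.
have [g [mg [C gC] nG]] := sW r0.
have /choice [phi hphi] : forall N, exists k, (N <= k)%N /\
    exists x y, eps < v k x - v k y.
  move=> N; apply: contrapT => h; apply: nosc; exists N => k x y Nk.
  rewrite leNgt; apply/negP => hk; apply: h; exists k; split => //.
  by exists x, y.
have Lv k : L1 (v k).
  apply: (@L1_bounded _ _ _ P _ B (mv k)) => x.
  by case/andP: (vB k x) => h1 h2; rewrite ger0_norm.
have Lg : L1 g by exact: L1_bounded mg gC.
have C0 : 0 <= C by apply: le_trans (gC point).
have Lgv k : L1 (fun x => g x * v k x).
  apply: (@L1_bounded _ _ _ P _ (C * B)); first exact: measurable_funM.
  move=> x; rewrite normrM ler_pM//.
  by case/andP: (vB k x) => h1 h2; rewrite ger0_norm.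
(* The pairings with the fixed [g] are bounded reals, so Bolzano-Weierstrass makes them converge
   along a subsequence. *)
pose a N := \int[P]_x (g x * v (phi N) x).
have bnd_a : bounded_fun a.
  exists (C * B); split; first exact: num_real.
  move=> M CM N _ /=; rewrite (le_trans _ (ltW CM))//.
  rewrite (le_trans (Rint_norm (Lgv _)))// -[leRHS](Rint_cst P).
  apply: Rint_le; [exact/L1norm|exact: L1_cst|] => x /=.
  rewrite normrM ler_pM//.
  by case/andP: (vB (phi N) x) => h1 h2; rewrite ger0_norm.
have [f incf cvaf] := bolzano_weierstrass bnd_a.
pose w j := v (phi (f j)).
have jf j : (j <= phi (f j))%N.
  apply: (@leq_trans (f j)); last by case: (hphi (f j)).
  elim: j => // j IH; apply: (leq_ltn_trans IH).
  by have /increasing_seqP := incf; apply.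
have ew0 : (fun j => e (phi (f j))) @ \oo --> 0.
  apply/cvgrPdist_le => eta eta0; move/cvgrPdist_le : e0 => /(_ _ eta0)[N _ HN].
  exists N => // j /= Nj; apply: HN => /=; exact: leq_trans (jf j).
have ew_ge0 j : 0 <= e (phi (f j)) by apply: le_trans (hv _ point).
have wB j x : 0 <= w j x <= B by exact: vB.
have [|c [cae cub]] := subharmonic_limsup d0 kW cW (fun j => mv (phi (f j))) wB ew0.
  by move=> k x; have := hv (phi (f k)) x; rewrite ler_norml => /andP[_]; lra.
have wB' j x : 0 <= B - w j x <= B.
  by case/andP: (wB j x) => h1 h2; rewrite subr_ge0 h2 gerBl h1.
have mw' j : measurable_fun setT (fun x => B - w j x).
  by apply: measurable_funB => //; exact: mv.
have [|c' [c'ae c'ub]] := subharmonic_limsup d0 kW cW mw' wB' ew0.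
  move=> k x; rewrite (kopB kW _ (L1_cst P B)) ?(kop_cst kW); last exact: Lv.
  by have := hv (phi (f k)) x; rewrite ler_norml => /andP[+ _]; rewrite /w; lra.
suff cc : c + c' - B <= eps / 2.
  have e8 : 0 < eps / 8 by rewrite divr_gt0.
  have [N1 H1] := cub _ e8; have [N2 H2] := c'ub _ e8.
  have [_ [x [y hxy]]] := hphi (f (maxn N1 N2)).
  have := H1 (maxn N1 N2) x (leq_maxl _ _).
  have := H2 (maxn N1 N2) y (leq_maxr _ _).
  by rewrite /w => h1 h2; lra.
rewrite leNgt; apply/negP => cc.
(* The set where [W x] is near [g] is not negligible, so it meets the a.e. set where [c] and
   [B - c'] are approached. *)
have [x [Gx [cx c'x]]] : exists x, \int[P]_y `|W x y - g y| <= r /\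
   ((forall eps, 0 < eps -> forall N, exists2 k, (N <= k)%N & c - eps <= w k x) /\
   (forall eps, 0 < eps -> forall N, exists2 k, (N <= k)%N & c' - eps <= B - w k x)).
  apply: contrapT => nex; apply: nG.
  have [A [mA A0 hA]] : {ae P, forall x,
   ((forall eps, 0 < eps -> forall N, exists2 k, (N <= k)%N & c - eps <= w k x) /\
   (forall eps, 0 < eps -> forall N, exists2 k, (N <= k)%N & c' - eps <= B - w k x))}.
    by apply: filterS2 cae c'ae => x.
  exists A; split => // x Gx; apply: hA => /= hx; apply: nex.
  by exists x; split.
have : exists N, forall j, (N <= j)%N -> e (phi (f j)) <= r.
  move/cvgrPdist_le : ew0 => /(_ _ r0)[N _ HN].
  by exists N => j Nj; have := HN j Nj; rewrite sub0r normrN ger0_norm.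
move=> [N1 HN1].
have [N2 HN2] : exists N, forall j, (N <= j)%N -> `|a (f j) - lim (a \o f @ \oo)| <= r / 2.
  move/cvgrPdist_le : cvaf => /(_ (r / 2)); rewrite divr_gt0// => /(_ isT)[N _ HN].
  by exists N => j Nj; rewrite distrC; have := HN j Nj.
set N := maxn N1 N2; set l := lim _ in HN2.
(* Two late times at the same [x]: [w k x] is nearly [c] or more, [w m x] nearly [B - c'] or
   less. *)
have [k Nk hk] := cx r r0 N; have [m Nm hm] := c'x r r0 N.
have ek := HN1 k (leq_trans (leq_maxl _ _) Nk).
have em := HN1 m (leq_trans (leq_maxl _ _) Nm).
have ak := HN2 k (leq_trans (leq_maxr _ _) Nk).
have am := HN2 m (leq_trans (leq_maxr _ _) Nm).
have akm : a (f k) - a (f m) <= r.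
  by move: ak am; rewrite !ler_norml => /andP[h1 h2] /andP[h3 h4]; lra.
have Lw j : L1 (w j) by exact: Lv.
have Lwkm : L1 (fun y => w k y - w m y) by exact: L1B.
have Lgkm : L1 (fun y => g y * w k y - g y * w m y) by apply: L1B; exact: Lgv.
have LWg : L1 (fun y => `|W x y - g y|).
  by apply/L1norm/L1B => //; exact: (kernel_L1 kW).
(* Replacing [W x] by [g] costs at most [B * r], since [w k] and [w m] differ by at most [B]; what
   remains is a difference of two pairings. *)
have : kop P W (w k) x - kop P W (w m) x <= B * r + (a (f k) - a (f m)).
  rewrite -(kopB kW)// /a -RintB; [|exact: Lgv..].
  rewrite -lerBlDr -RintB//; last exact: (kopL1 kW).
  apply: (@le_trans _ _ (\int[P]_y (B * `|W x y - g y|))).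
    apply: Rint_le; [|exact: L1Z|move=> y].
      by apply: L1B => //; exact: (kopL1 kW).
    rewrite (_ : _ - _ = (w k y - w m y) * (W x y - g y)); last by rewrite /w; ring.
    rewrite (le_trans (ler_norm _))// normrM ler_wpM2r//.
    case/andP: (wB k y) => h1 h2; case/andP: (wB m y) => h3 h4.
    by rewrite ler_norml; apply/andP; split; lra.
  by rewrite RintZ// ler_wpM2l.
have := hv (phi (f k)) x; have := hv (phi (f m)) x; rewrite -/(w _).
rewrite !ler_norml => /andP[h1 h2] /andP[h3 h4] h5.
have h6 : D x * (w k x - w m x) <= (B + 3) * r by rewrite -/(w k) -/(w m) in h1 h2 h3 h4; lra.
have d1 := kdeg_lb_le1.
have Dx := kdeg_ge kW x.
have h7 : eps / 2 - 2 * r < w k x - w m x by lra.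
have rd : r * d <= r by rewrite ler_piMr// ltW.
(* Replacing [D x] by [d] needs a positive difference; otherwise [h7] already gives [eps <= 4 * r],
   too large for [r]. *)
have [h8|h8] := leP (w k x - w m x) 0.
  have : eps <= 4 * r by lra.
  have h9 : (B + 6) * r * d = eps * d / 2 * d by rewrite rE.
  have : B * r >= 0 by rewrite mulr_ge0// ltW.
  have : eps * d <= eps by rewrite ler_piMr// ltW.
  by lra.
have h9 : d * (w k x - w m x) <= (B + 3) * r.
  by rewrite (le_trans _ h6)// ler_wpM2r// ltW.
have h10 : d * (eps / 2 - 2 * r) < d * (w k x - w m x) by rewrite ltr_pM2l.
by lra.
Qed.

Variables (sigma : T -> R) (C : R).
Hypothesis msigma : measurable_fun setT sigma.
Hypothesis sigma_ge0 : forall x, 0 <= sigma x.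
Hypothesis sigma_le : forall x, sigma x <= C.
Local Notation u_ := (kodo P W sigma).

Let Ls : L1 sigma.
Proof. by apply: (@L1_bounded _ _ _ P _ C) => // x; rewrite ger0_norm. Qed.

(** The limit is the supremum of the ratios [l / n] over integers [l <= u_ n]. Comparing [u_] at
    time [m * n] shows each of them below every ratio [k / m] coming from an upper bound
    [u_ m <= k]. With oscillation at most [eps * n], the value [u_ n x] is within [eps * n] of being
    a bound of either kind. *)
Theorem kodo_activity : exists a : R,
  [/\ forall eps, 0 < eps -> exists N, forall n x, (N <= n)%N ->
        `|u_ n x / n%:R - a| <= eps,
      forall n (k : R), (0 < n)%N -> (forall x, u_ n x <= k) -> a <= k / n%:R &
      forall n (k : R), (0 < n)%N -> (forall x, k <= u_ n x) -> k / n%:R <= a].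
Proof.
have C0 : 0 <= C by apply: le_trans (sigma_le point).
pose c : R := (Num.floor (C / d))%:~R.
have cz : c \is a Num.int by exact: intr_int.
have c0 : 0 <= c by rewrite ler0z floor_ge0 divr_ge0// ltW.
have u1 x : u_ 1 x <= c.
  apply: kodo_int_ub => y; rewrite (le_trans (kstep_le _ _ _ _ _))//.
  rewrite (kop_cst kW) mul0r addr0.
  have D0 := kdeg_gt0 d0 kW y.
  apply: ler_pM; [exact: sigma_ge0|by rewrite invr_ge0 ltW|exact: sigma_le|].
  by rewrite lef_pV2 ?posrE// (kdeg_ge kW).
have un n x : u_ n x <= n%:R * c.
  by have := kodo_mul_le d0 kW Ls sigma_ge0 cz u1 n x; rewrite muln1.
have Lu := kodo_L1 d0 kW Ls sigma_ge0.
have u0 := kodo_ge0 d0 kW sigma_ge0.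
(* The index shift avoids dividing by zero. The numerator of [e] bounds [D u - T u]: the
   configuration lies between 0 and [1 + c], and [sigma] between 0 and [C]. *)
pose v k x := (k.+1%:R)^-1 * u_ k.+1 x.
pose e k : R := (1 + C + c) * (k.+1%:R)^-1.
have mv k : measurable_fun setT (v k).
  by apply: measurable_funM => //; exact: L1_measurable (Lu _).
have vB k x : 0 <= v k x <= c.
  apply/andP; split; first by apply: mulr_ge0; [rewrite invr_ge0|exact: u0].
  by rewrite /v mulrC ler_pdivrMr ?ltr0n// mulrC; exact: un.
have e0 : e @ \oo --> 0.
  rewrite -[X in _ --> X](mulr0 (1 + C + c)); apply: cvgMr.
  exact: cvg_harmonic.
have hv k x : `|D x * v k x - kop P W (v k) x| <= e k.
  rewrite /v (kopZ kW _ _ (Lu _)) mulrCA -mulrBr normrM ger0_norm ?invr_ge0//.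
  rewrite /e mulrC ler_wpM2r ?invr_ge0//.
  have h1 := kodo_config_ge0 d0 kW Ls sigma_ge0 k.+1 x.
  have h2 := kodo_config_le d0 kW sigma k x.
  have h3 : kop P W (u_ k.+1) x - kop P W (u_ k) x <= c.
    rewrite lerBlDr; apply: (@le_trans _ _ (kop P W (fun y => u_ k y + c) x)).
      apply: (kop_le kW) => //; first by apply: L1D => //; exact: L1_cst.
      by move=> y; have := kodo_addl_le d0 kW Ls sigma_ge0 cz u1 k y; rewrite addn1.
    rewrite (kopD kW _ (Lu k) (L1_cst P c)) (kop_cst kW) addrC lerD2r.
    by rewrite ler_piMr// (kdeg_le1 kW).
  have h4 := kdeg_le1 kW x; have h5 := sigma_ge0 x; have h6 := sigma_le x.
  by rewrite ler_norml; apply/andP; split; lra.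
have osc := almost_harmonic_osc mv vB e0 hv.
pose S := [set q : R | exists n (l : R), [/\ (0 < n)%N, l \is a Num.int,
   forall x, l <= u_ n x & q = l / n%:R]].
have S_ub n k : (0 < n)%N -> k \is a Num.int -> (forall x, u_ n x <= k) ->
    forall q, S q -> q <= k / n%:R.
  move=> n0 kz uk q [m [l [m0 lz ul ->]]].
  rewrite ler_pdivrMr ?ltr0n// mulrAC ler_pdivlMr ?ltr0n//.
  have := kodo_mul_ge d0 kW Ls sigma_ge0 lz ul n point.
  have := kodo_mul_le d0 kW Ls sigma_ge0 kz uk m point.
  by rewrite mulnC => h1 h2; rewrite mulrC [k * _]mulrC (le_trans h2).
have S_supP : has_sup S.
  split; first by exists 0, 1%N, 0; split; rewrite ?mul0r ?rpred0.
  by exists c => q /(S_ub 1%N c isT cz u1); rewrite divr1.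
have up n (k : R) : (0 < n)%N -> (forall x, u_ n x <= k) -> sup S <= k / n%:R.
  move=> n0 uk; apply: (@le_trans _ _ ((Num.floor k)%:~R / n%:R)).
    apply: ge_sup; first by case: S_supP.
    by apply: S_ub => //; exact: kodo_int_ub.
  by rewrite ler_wpM2r ?invr_ge0// floor_le.
have low n (k : R) : (0 < n)%N -> (forall x, k <= u_ n x) -> k / n%:R <= sup S.
  move=> n0 uk; apply: (@le_trans _ _ ((Num.ceil k)%:~R / n%:R)).
    by rewrite ler_wpM2r ?invr_ge0// ceil_ge.
  apply: ub_le_sup; first by case: S_supP.
  exists n, (Num.ceil k)%:~R; split => // x; rewrite -(floorK (kodo_int P W sigma n x)) ler_int.
  by rewrite ceil_le_int (floorK (kodo_int P W sigma n x)).
exists (sup S); split => // eps eps0.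
have [N HN] := osc eps eps0.
exists N.+1 => -[//|n] x Nn.
have n0 : 0 < n.+1%:R :> R by rewrite ltr0n.
have hosc y z : u_ n.+1 y <= u_ n.+1 z + eps * n.+1%:R.
  have := HN n y z Nn; rewrite /v -mulrBr mulrC ler_pdivrMr//; lra.
rewrite ler_norml; apply/andP; split.
  rewrite lerBrDr addrC lerBlDr.
  apply: (le_trans (up n.+1 _ isT (fun y => hosc y x))).
  by rewrite mulrDl mulfK ?gt_eqF.
rewrite lerBlDr -lerBlDl.
apply: le_trans (low n.+1 (u_ n.+1 x - eps * n.+1%:R) isT _).
  by rewrite mulrBl mulfK ?gt_eqF.
by move=> y; rewrite lerBlDr.
Qed.

End activity_exists.

(** * Continuity in the cut norm *)

Section cut_continuity.
Context (disp : measure_display) (T : measurableType disp) (R : realType).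
Variable P : probability T R.
Local Notation L1 f := (P.-integrable setT (EFin \o f)).

(** The cut norm tested on indicators, with the inner integral written through [kop], the operator
    in the recursion. *)
Definition kcut (W W' : T -> T -> R) (delta : R) : Prop :=
  forall A B : set T, measurable A -> measurable B ->
  `|\int[P]_x (\1_A x * (kop P W \1_B x - kop P W' \1_B x))| <= delta.

Section two_kernels.
Variables (d : R) (W W' : T -> T -> R) (delta : R).
Hypothesis d0 : 0 < d.
Hypothesis kW : degkernel P d W.
Hypothesis kW' : degkernel P d W'.
Hypothesis cutW : kcut W W' delta.

Let indic_ge0 (B : set T) x : 0 <= (\1_B x : R). Proof. by rewrite indicE. Qed.

(** Splitting at the sign of the integrand turns the L^1 norm into two cuts, over [A] and its
    complement; hence the factor 2. *)
Lemma cut_indic (B : set T) : measurable B ->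
  \int[P]_x `|kop P W \1_B x - kop P W' \1_B x| <= 2 * delta.
Proof.
move=> mB; pose f x := kop P W \1_B x - kop P W' \1_B x.
have LB : L1 (\1_B : T -> R) by exact: L1_indic.
have Lf : L1 f.
  by apply: L1B; [apply: (kop_L1 kW) | apply: (kop_L1 kW')].
pose A := [set x | 0 <= f x].
have mA : measurable A.
  rewrite /A -[X in measurable X]setTI.
  by apply: (measurable_fun_ler (measurable_cst (0 : R)) (L1_measurable Lf) measurableT).
have LA (E : set T) : measurable E -> L1 (fun x => \1_E x * f x).
  move=> mE; rewrite (_ : (fun _ => _) = (fun x => f x * \1_E x)); last first.
    by apply/funext => x; rewrite mulrC.
  apply: (L1M Lf); first exact: measurable_indic.
  by move=> x; rewrite indicE; case: (_ \in _); rewrite ?normr1 ?normr0.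
rewrite (_ : \int[P]_x _ =
   \int[P]_x (\1_A x * f x) - \int[P]_x (\1_(~` A) x * f x)).
  have := cutW mA mB; have := cutW (measurableC mA) mB.
  by rewrite !ler_norml -/f => /andP[h1 h2] /andP[h3 h4]; lra.
rewrite -RintB; [|exact: LA|exact/LA/measurableC].
apply: eq_Rintegral => x _; rewrite -/(f x) !indicE in_setC.
have [xA|xA] := boolP (x \in A).
  by rewrite /= mul1r mul0r subr0 ger0_norm//; move: xA; rewrite inE.
rewrite /= mul0r mul1r sub0r ler0_norm// ltW// ltNge; apply/negP => h.
by move: xA; rewrite notin_setE; apply.
Qed.

Lemma cut_kdeg : \int[P]_x `|kdeg P W x - kdeg P W' x| <= 2 * delta.
Proof.
apply: le_trans (cut_indic measurableT); rewrite le_eqVlt; apply/orP; left.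
apply/eqP/eq_Rintegral => x _.
have -> : (\1_setT : T -> R) = cst 1.
  by apply/funext => y; rewrite indicE in_setT.
by rewrite (kop_cst kW) (kop_cst kW') !mul1r.
Qed.

Lemma min_natS (z : R) (K : nat) : z \is a Num.int ->
  Num.min z K.+1%:R = Num.min z K%:R + (K.+1%:R <= z)%R%:R.
Proof.
move=> zz; have [h|h] := leP K.+1%:R z.
  rewrite [Num.min z K%:R]min_r ?natr1//.
  by apply: le_trans h; rewrite ler_nat.
rewrite addr0; rewrite [RHS]min_l//.
move: h; rewrite -(floorK zz) -![_%:R]/(_%:Z%:~R) ltr_int ler_int.
by rewrite intS addrC ltzD1.
Qed.

(** A non-negative integer function truncated at [K] is the sum of the indicators of its first [K]
    level sets, each costing [2 * delta]. *)
Lemma cut_min (u : T -> R) (K : nat) : L1 u -> (forall x, 0 <= u x) ->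
  (forall x, u x \is a Num.int) ->
  let m x := Num.min (u x) K%:R in
  \int[P]_x `|kop P W m x - kop P W' m x| <= 2 * K%:R * delta.
Proof.
move=> Lu u0 uz /=; have mu := L1_measurable Lu.
pose m k x := Num.min (u x) k%:R.
have m0 k x : 0 <= m k x by rewrite /m le_min u0 ler0n.
have Lm k : L1 (m k).
  apply: L1_le Lu _; first by apply: measurable_minr.
  by move=> x; rewrite ger0_norm// /m ge_min lexx.
elim: K => [|K IH].
  rewrite mulr0 mul0r.
  rewrite -[leRHS](Rint_cst P) le_eqVlt; apply/orP; left.
  apply/eqP/eq_Rintegral => x _.
  have -> : (fun x => Num.min (u x) 0%:R) = cst 0.
    by apply/funext => y; rewrite min_r.
  by rewrite (kop_cst kW) (kop_cst kW') !mul0r subr0 normr0.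
pose B := [set x | K.+1%:R <= u x].
have mB : measurable B.
  rewrite /B -[X in measurable X]setTI.
  by apply: (measurable_fun_ler (measurable_cst _) mu measurableT).
have LB : L1 (\1_B : T -> R) by exact: L1_indic.
have mE : (fun x => Num.min (u x) K.+1%:R) = fun x => m K x + \1_B x.
  apply/funext => x; rewrite min_natS// /m indicE; congr (_ + _%:R).
  by congr nat_of_bool; apply/idP/idP; rewrite inE.
rewrite mE.
have Ld : L1 (fun x => `|kop P W (m K) x - kop P W' (m K) x|).
  by apply/L1norm/L1B; [exact: (kop_L1 kW)|exact: (kop_L1 kW')].
have Ld' : L1 (fun x => `|kop P W \1_B x - kop P W' \1_B x|).
  by apply/L1norm/L1B; [apply: (kop_L1 kW)|apply: (kop_L1 kW')].
apply: (@le_trans _ _ (\int[P]_x (`|kop P W (m K) x - kop P W' (m K) x| +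
   `|kop P W \1_B x - kop P W' \1_B x|))).
  apply: Rint_le; [|exact: L1D|move=> x].
    apply/L1norm/L1B; [apply: (kop_L1 kW)|apply: (kop_L1 kW')];
      by [exact: L1D|move=> x; rewrite addr_ge0].
  rewrite (kopD kW)// (kopD kW')//.
  rewrite (_ : _ - _ = (kop P W (m K) x - kop P W' (m K) x) +
     (kop P W \1_B x - kop P W' \1_B x)); last by ring.
  exact: ler_normD.
rewrite RintD//; have := cut_indic mB; move: IH; rewrite -natr1 /m; lra.
Qed.

(** The truncation is covered by [cut_min]; both operators send the tail [t] into the interval from
    0 to its integral. *)
Lemma cut_int (u : T -> R) (K : nat) : L1 u -> (forall x, 0 <= u x) ->
  (forall x, u x \is a Num.int) ->
  \int[P]_x `|kop P W u x - kop P W' u x| <=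
  2 * K%:R * delta + \int[P]_x (u x - Num.min (u x) K%:R).
Proof.
move=> Lu u0 uz; have mu := L1_measurable Lu.
pose m x := Num.min (u x) K%:R; pose t x := u x - m x.
have m0 x : 0 <= m x by rewrite /m le_min u0 ler0n.
have Lm : L1 m.
  apply: L1_le Lu _; first by apply: measurable_minr.
  by move=> x; rewrite ger0_norm// /m ge_min lexx.
have Lt : L1 t by exact: L1B.
have t0 x : 0 <= t x by rewrite /t subr_ge0 /m ge_min lexx.
have uE : u = fun x => m x + t x by apply/funext => x; rewrite /t addrC subrK.
have Ld : L1 (fun x => `|kop P W m x - kop P W' m x|).
  by apply/L1norm/L1B; [exact: (kop_L1 kW)|exact: (kop_L1 kW')].
rewrite -[X in _ <= _ + X](Rint_cst P).
apply: le_trans (lerD (cut_min K Lu u0 uz) (lexx _)).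
rewrite -RintD//; last exact: L1_cst.
apply: Rint_le; [|by apply: L1D => //; exact: L1_cst|move=> x].
  by apply/L1norm/L1B; [exact: (kop_L1 kW)|exact: (kop_L1 kW')].
have E V : degkernel P d V -> kop P V u x = kop P V m x + kop P V t x.
  by move=> kV; rewrite -(kopD kV)//; congr kop.
rewrite (E W kW) (E W' kW') /=.
rewrite (_ : _ - _ = (kop P W m x - kop P W' m x) + (kop P W t x - kop P W' t x)); last by ring.
rewrite (le_trans (ler_normD _ _))// lerD2l.
have h1 := kop_ge0 kW x t0; have h2 := kop_ge0 kW' x t0.
have h3 := kop_le_int kW x Lt t0; have h4 := kop_le_int kW' x Lt t0.
by rewrite ler_norml; apply/andP; split; lra.
Qed.

End two_kernels.

(** The floors agree unless [s] is within [k] of an integer or [s'] is at distance at least [k] from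
    [s]. Always they differ by at most the distance plus 1, and in each exceptional case one of the
    last three terms pays for that 1. *)
Lemma floor_dist (s s' k : R) : 0 < k ->
  `|(Num.floor s)%:~R - (Num.floor s')%:~R : R| <=
  `|s - s'| + (s - (Num.floor s)%:~R < k)%R%:R + ((Num.floor s)%:~R + 1 - s < k)%R%:R
   + `|s - s'| / k.
Proof.
move=> k0.
have b1 := ler0n R (s - (Num.floor s)%:~R < k)%R.
have b2 := ler0n R ((Num.floor s)%:~R + 1 - s < k)%R.
have b3 : 0 <= `|s - s'| by [].
have b4 : 0 <= `|s - s'| / k by rewrite divr_ge0// ltW.
have far : `|(Num.floor s)%:~R - (Num.floor s')%:~R : R| <= `|s - s'| + 1.
  have /andP[h1 h2] := floor_itv s; have /andP[h3 h4] := floor_itv s'.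
  move: h2 h4; rewrite !intrD1 => h2 h4.
  have := ler_norm (s - s'); have := ler_norm (s' - s); rewrite [`|s' - _|]distrC.
  by rewrite ler_norml => h5 h6; apply/andP; split; lra.
have [h1|h1] := ltP (s - (Num.floor s)%:~R) k; first by rewrite /=; lra.
have [h2|h2] := ltP ((Num.floor s)%:~R + 1 - s) k; first by rewrite /=; lra.
have [h3|h3] := ltP (`|s - s'|) k.
  have -> : Num.floor s' = Num.floor s.
    apply: floor_def; rewrite intrD1.
    by move: h3; rewrite ltr_norml => /andP[h4 h5]; apply/andP; split; lra.
  by rewrite subrr normr0 !addr_ge0.
have : 1 <= `|s - s'| / k by rewrite ler_pdivlMr// mul1r.
rewrite /=; lra.
Qed.

(** Dominated convergence along [k = 1 / (n + 1)]: the indicators tend to that of the points where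
    [s] is an integer, a null set. *)
Lemma near_int_small (s : T -> R) : measurable_fun setT s ->
  P.-negligible [set x | s x \is a Num.int] -> forall eps, 0 < eps ->
  exists2 k : R, 0 < k &
    \int[P]_x ((s x - (Num.floor (s x))%:~R < k)%R%:R
      + ((Num.floor (s x))%:~R + 1 - s x < k)%R%:R) <= eps.
Proof.
move=> ms ns eps eps0.
have mf := measurable_floor ms.
pose k (n : nat) : R := n.+1%:R^-1.
pose F n x : R := (s x - (Num.floor (s x))%:~R < k n)%R%:R
      + ((Num.floor (s x))%:~R + 1 - s x < k n)%R%:R.
have mF n : measurable_fun setT (F n).
  apply: measurable_funD; apply: measurable_natr_bool; rewrite -[X in measurable X]setTI.
    by apply: (measurable_fun_ltr (measurable_funB ms mf) (measurable_cst _) measurableT).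
  by apply: (measurable_fun_ltr (measurable_funB (measurable_funD mf (measurable_cst _)) ms)
    (measurable_cst _) measurableT).
pose G x : R := (s x == (Num.floor (s x))%:~R)%:R.
have mG : measurable_fun setT G.
  apply: measurable_natr_bool; rewrite -[X in measurable X]setTI.
  by apply: (measurable_fun_eqr ms mf measurableT).
have FG x : F ^~ x @ \oo --> G x.
  have /andP[h1 h2] := floor_itv (s x); rewrite intrD1 in h2.
  have kk (t : R) : 0 < t -> exists N, forall n, (N <= n)%N -> k n < t.
    move=> t0; have /cvgrPdist_lt /(_ _ t0) [N _ HN] := @cvg_harmonic R.
    exists N => n Nn; have := HN n Nn; rewrite sub0r normrN /harmonic.
    by rewrite ger0_norm// invr_ge0.
  apply/cvgrPdist_le => e e0.
  have [N2 HN2] := kk ((Num.floor (s x))%:~R + 1 - s x) ltac:(lra).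
  rewrite /G; have [h|h] := eqVneq (s x) (Num.floor (s x))%:~R.
    exists N2 => // n Nn; rewrite /F (ltNge _ (k n)) (ltNge _ (k n)).
    have h' : s x - (Num.floor (s x))%:~R = 0 by rewrite {1}h subrr.
    rewrite (ltW (HN2 n Nn)) /= addr0 h' -ltNge invr_gt0 ltr0n.
    by rewrite subrr normr0 ltW.
  have [N1 HN1] := kk (s x - (Num.floor (s x))%:~R) ltac:(by rewrite subr_gt0 lt_neqAle eq_sym h).
  exists (maxn N1 N2) => // n; rewrite /= geq_max => /andP[n1 n2]; rewrite /F.
  rewrite !(ltNge _ (k n)) (ltW (HN1 n n1)) (ltW (HN2 n n2)) /=.
  by rewrite addr0 subr0 normr0 ltW.
have FB n x : `|F n x| <= 2.
  rewrite ger0_norm ?addr_ge0// /F.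
  by case: (_ < _); case: (_ < _); rewrite /=; lra.
have G0 : \int[P]_x G x = 0.
  rewrite (@Rint_ae_eq _ _ _ P G (cst 0)) ?Rint_cst//; last 2 first.
  - exact: L1_cst.
  - have [A [mA A0 hA]] := ns; exists A; split => // x /= Gx; apply: hA => /=.
    move: Gx; rewrite /G; case: eqP => [-> _|//]; exact: intr_int.
  apply: (@L1_bounded _ _ _ P _ 1) => // x.
  by rewrite /G; case: (_ == _); rewrite ?normr0 ?normr1.
have := Rint_cvg mF mG FG (L1_cst P 2) FB.
rewrite G0 => /cvgrPdist_le /(_ _ eps0)[N _ /(_ N (leqnn N))].
rewrite sub0r normrN => h; exists (k N); first by rewrite invr_gt0.
by apply: le_trans h; exact: ler_norm.
Qed.

End cut_continuity.

(** * L^1 continuity of the odometer at a smooth pair *)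

Section odometer_continuity.
Context (disp : measure_display) (T : measurableType disp) (R : realType).
Variable P : probability T R.
Local Notation L1 f := (P.-integrable setT (EFin \o f)).
Variables (d : R) (W : T -> T -> R) (sigma : T -> R).
Hypothesis d0 : 0 < d.
Hypothesis kW : degkernel P d W.
Hypothesis Ls : L1 sigma.
Hypothesis s0 : forall x, 0 <= sigma x.
Local Notation D := (kdeg P W).

(** The quotients [s] and [s'] are close in L^1, by the cut norm for [u] and for the degrees;
    [floor_dist] carries this through the floor because [s] is a.e. not an integer. The modulus
    depends on [W], [sigma] and [u] alone. *)
Lemma kstep_cont (u : T -> R) : L1 u -> (forall x, 0 <= u x) ->
  (forall x, u x \is a Num.int) ->
  P.-negligible [set x | (sigma x + kop P W u x) / D x \is a Num.int] ->
  forall eps, 0 < eps -> exists2 delta, 0 < delta &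
  forall W' sigma' u', degkernel P d W' -> kcut P W W' delta ->
    L1 sigma' -> (forall x, 0 <= sigma' x) ->
    \int[P]_x `|sigma x - sigma' x| <= delta ->
    L1 u' -> (forall x, 0 <= u' x) -> \int[P]_x `|u x - u' x| <= delta ->
  \int[P]_x `|kstep P W sigma u x - kstep P W' sigma' u' x| <= eps.
Proof.
move=> Lu u0 uz ns eps eps0.
pose h x := sigma x + kop P W u x; pose s x := h x / D x.
have Lh : L1 h by apply: L1D => //; exact: (kop_L1 kW).
have h0 x : 0 <= h x by rewrite addr_ge0// (kop_ge0 kW).
have ms : measurable_fun setT s by apply: (measurable_div_kdeg d0 kW); exact: L1_measurable Lh.
have e3 : 0 < eps / 3 by rewrite divr_gt0.
have [k k0 Zk] := near_int_small ms ns e3.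
(* The L^1 distance of [s] and [s'] will be at most [4 * eta / d ^+ 2 = q * (eps / 3)]; as [q <= 1]
   and [q <= k], both distance terms of [floor_dist] stay below [eps / 3]. *)
pose q := Num.min 1 k.
have q0 : 0 < q by rewrite lt_min ltr01 k0.
have q1 : q <= 1 by rewrite ge_min lexx.
have qk : q <= k by rewrite ge_min lexx orbT.
pose eta := q * (eps / 3) * d ^+ 2 / 4.
have eta0 : 0 < eta by rewrite divr_gt0// mulr_gt0 ?exprn_gt0// mulr_gt0.
(* [K1] truncates [u] in the cut estimate, [K2] truncates [h] against the change of degree; [delta]
   then absorbs both levels. *)
have [K1 tu] := L1_tail Lu u0 eta0; have [K2 th] := L1_tail Lh h0 eta0.
pose delta := eta / (2 + 2 * K1%:R + 2 * K2%:R).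
have K0 : 0 < 2 + 2 * K1%:R + 2 * K2%:R :> R.
  have := ler0n R K1; have := ler0n R K2; lra.
have dE : (2 + 2 * K1%:R + 2 * K2%:R) * delta = eta.
  by rewrite /delta mulrC divfK// gt_eqF.
exists delta; first exact: divr_gt0.
move=> W' sigma' u' kW' cW Ls' s'0 ss Lu' u'0 uu.
have delta0 : 0 < delta by exact: divr_gt0.
pose h' x := sigma' x + kop P W' u' x; pose D' := kdeg P W'.
pose s' x := h' x / D' x.
have Lh' : L1 h' by apply: L1D => //; exact: (kop_L1 kW').
have Lhh : L1 (fun x => `|h x - h' x|) by exact/L1norm/L1B.
have LDD : L1 (fun x => `|D x - D' x|).
  apply: (@L1_bounded _ _ _ P _ 1).
    apply: measurableT_comp => //.
    by apply: measurable_funB; [exact: (measurable_kdeg kW)|exact: (measurable_kdeg kW')].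
  move=> x; rewrite normr_id.
  have := kdeg_le1 kW x; have := kdeg_le1 kW' x.
  have := kdeg_gt0 d0 kW x; have := kdeg_gt0 d0 kW' x; rewrite -/(D' x) => *.
  by rewrite ler_norml; apply/andP; split; lra.
have DD1 x : `|D x - D' x| <= 1.
  have := kdeg_le1 kW x; have := kdeg_le1 kW' x.
  have := kdeg_gt0 d0 kW x; have := kdeg_gt0 d0 kW' x; rewrite -/(D' x) => *.
  by rewrite ler_norml; apply/andP; split; lra.
have Lkk : L1 (fun x => `|kop P W u x - kop P W' u x|).
  by apply/L1norm/L1B; [exact: (kop_L1 kW)|exact: (kop_L1 kW')].
have Lss : L1 (fun x => `|sigma x - sigma' x|) by exact/L1norm/L1B.
have Lm (K : nat) : L1 (fun x => h x - Num.min (h x) K%:R).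
  apply: (L1_le _ Lh).
    apply: measurable_funB; first exact: L1_measurable Lh.
    by apply: measurable_minr => //; exact: L1_measurable Lh.
  move=> x; rewrite ger0_norm ?subr_ge0 ?ge_min ?lexx//.
  by rewrite gerBl le_min h0 ler0n.
have hh : \int[P]_x `|h x - h' x| <=
    delta + (2 * K1%:R * delta + eta) + delta.
  apply: (@le_trans _ _ (\int[P]_x ((`|sigma x - sigma' x| +
      `|kop P W u x - kop P W' u x|) + cst delta x))).
    apply: Rint_le => //; first by apply: L1D; [exact: L1D|exact: L1_cst].
    move=> x.
    rewrite (_ : h x - h' x = (sigma x - sigma' x) + (kop P W u x - kop P W' u x)
       + (kop P W' u x - kop P W' u' x)); last by rewrite /h /h'; ring.
    apply: (le_trans (ler_normD _ _)); apply: lerD; first exact: ler_normD.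
    rewrite -(kopB kW')//; apply: (le_trans (kop_norm kW' _ _)) => //.
    exact: L1B.
  rewrite RintD ?Rint_cst; [|exact: L1D|exact: L1_cst].
  rewrite RintD// lerD2r lerD//.
  by apply: (le_trans (cut_int kW kW' cW K1 Lu u0 uz)); rewrite lerD2l.
have LhD : L1 (fun x => h x * `|D x - D' x|).
  apply: L1M => //; first exact: L1_measurable LDD.
  by move=> x; rewrite normr_id.
(* Below level [K2] the L^1 distance of the degrees is used, above it only that they differ by at
   most 1. *)
have hD : \int[P]_x (h x * `|D x - D' x|) <= K2%:R * (2 * delta) + eta.
  apply: (@le_trans _ _ (\int[P]_x (K2%:R * `|D x - D' x| +
     (h x - Num.min (h x) K2%:R)))).
    apply: Rint_le => //; first by apply: L1D => //; exact: L1Z.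
    move=> x; have := DD1 x; have := normr_ge0 (D x - D' x).
    set z := `|_| => z0 z1; have := h0 x.
    have [hK|hK] := leP (h x) K2%:R => hx; rewrite ?subrr ?addr0.
      by rewrite ler_wpM2r.
    have : (h x - K2%:R) * z <= h x - K2%:R by rewrite ler_piMr// subr_ge0 ltW.
    by rewrite mulrBl; lra.
  rewrite RintD//; last exact: L1Z.
  by rewrite RintZ// lerD// ler_wpM2l// (cut_kdeg kW kW' cW).
have Lds : L1 (fun x => d^-1 * `|h x - h' x| + (d ^+ 2)^-1 * (h x * `|D x - D' x|)).
  by apply: L1D; apply: L1Z.
have sd x : `|s x - s' x| <=
    d^-1 * `|h x - h' x| + (d ^+ 2)^-1 * (h x * `|D x - D' x|).
  have Dx := kdeg_ge kW x; have D'x := kdeg_ge kW' x; rewrite -/(D' x) in D'x.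
  have Dx0 := kdeg_gt0 d0 kW x; have D'x0 := kdeg_gt0 d0 kW' x; rewrite -/(D' x) in D'x0.
  rewrite (_ : s x - s' x = (D' x)^-1 * (h x - h' x) +
     (D x * D' x)^-1 * (h x * (D' x - D x))); last first.
    by rewrite /s /s'; field; rewrite !gt_eqF.
  rewrite (le_trans (ler_normD _ _))// lerD// !normrM.
    rewrite ler_wpM2r// ger0_norm ?invr_ge0 ?(ltW D'x0)//.
    by rewrite lef_pV2 ?posrE.
  rewrite (ger0_norm (h0 x)) [`|D' x - _|]distrC ler_wpM2r ?mulr_ge0//.
  have DD0 : 0 < D x * D' x by exact: mulr_gt0.
  rewrite ger0_norm ?invr_ge0 ?(ltW DD0)// lef_pV2 ?posrE ?exprn_gt0//.
  by rewrite expr2 ler_pM// ltW.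
have ms' : measurable_fun setT s' by apply: (measurable_div_kdeg d0 kW'); exact: L1_measurable Lh'.
have Lss' : L1 (fun x => `|s x - s' x|).
  apply: (L1_le _ Lds); last by move=> x; rewrite normr_id.
  by apply: measurableT_comp => //; exact: measurable_funB.
have d1 := kdeg_lb_le1 kW.
have intS : \int[P]_x `|s x - s' x| <= q * (eps / 3).
  apply: (le_trans (Rint_le Lss' Lds sd)).
  rewrite RintD ?RintZ//; [|exact: L1Z..].
  have -> : q * (eps / 3) = (d ^+ 2)^-1 * (4 * eta).
    by rewrite /eta; field; rewrite gt_eqF.
  have d2 : 0 < d ^+ 2 by rewrite exprn_gt0.
  have dd : d^-1 <= (d ^+ 2)^-1.
    by rewrite lef_pV2 ?posrE// expr2 ler_piMr// ltW.
  have hh' : \int[P]_x `|h x - h' x| <= 2 * eta.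
    apply: (le_trans hh); rewrite -{2}dE.
    have : 0 <= K2%:R * delta by rewrite mulr_ge0// ltW.
    lra.
  have hD' : \int[P]_x (h x * `|D x - D' x|) <= 2 * eta.
    apply: (le_trans hD); rewrite -{2}dE.
    have : 0 <= K1%:R * delta by rewrite mulr_ge0// ltW.
    lra.
  have i0 : 0 <= \int[P]_x `|h x - h' x| by exact: Rint_ge0.
  apply: (@le_trans _ _ ((d ^+ 2)^-1 * (2 * eta) + (d ^+ 2)^-1 * (2 * eta))); last lra.
  apply: lerD; last by rewrite ler_wpM2l// invr_ge0 ltW.
  by apply: ler_pM => //; rewrite invr_ge0 ltW.
pose Z x : R := (s x - (Num.floor (s x))%:~R < k)%R%:R
      + ((Num.floor (s x))%:~R + 1 - s x < k)%R%:R.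
have mf := measurable_floor ms.
have LZ : L1 Z.
  apply: (@L1_bounded _ _ _ P _ 2); last first.
    move=> x; rewrite ger0_norm ?addr_ge0// /Z.
    by case: (_ < _)%R; case: (_ < _)%R; rewrite /=; lra.
  apply: measurable_funD; apply: measurable_natr_bool; rewrite -[X in measurable X]setTI.
    by apply: (measurable_fun_ltr (measurable_funB ms mf) (measurable_cst _) measurableT).
  by apply: (measurable_fun_ltr (measurable_funB (measurable_funD mf (measurable_cst _)) ms)
    (measurable_cst _) measurableT).
have Lk : L1 (fun x => k^-1 * `|s x - s' x|) by exact: L1Z.
have LF : L1 (fun x => (`|s x - s' x| + Z x) + k^-1 * `|s x - s' x|).
  by apply: L1D => //; exact: L1D.
apply: (@le_trans _ _ (\int[P]_x ((`|s x - s' x| + Z x) + k^-1 * `|s x - s' x|))).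
  apply: Rint_le => //.
    by apply/L1norm/L1B; [exact: (kstep_L1 d0 kW)|exact: (kstep_L1 d0 kW')].
  move=> x; apply: (le_trans (floor_dist _ _ k0)).
  by rewrite addrA [k^-1 * _]mulrC.
rewrite RintD//; last exact: L1D.
rewrite RintD// RintZ//.
have : k^-1 * \int[P]_x `|s x - s' x| <= eps / 3.
  by rewrite mulrC ler_pdivrMr// mulrC (le_trans intS)// ler_wpM2r// ltW.
have : q * (eps / 3) <= eps / 3 by rewrite ler_piMl// ltW.
move: Zk intS; rewrite -/(Z _); lra.
Qed.

Hypothesis smooth : forall n, P.-negligible
  [set x | (sigma x + kop P W (kodo P W sigma n) x) / D x \is a Num.int].

Lemma kodo_cont n eps : 0 < eps -> exists2 delta, 0 < delta &
  forall W' sigma', degkernel P d W' -> kcut P W W' delta ->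
    L1 sigma' -> (forall x, 0 <= sigma' x) ->
    \int[P]_x `|sigma x - sigma' x| <= delta ->
  \int[P]_x `|kodo P W sigma n x - kodo P W' sigma' n x| <= eps.
Proof.
elim: n eps => [|n IH] eps eps0.
  exists 1 => // W' sigma' _ _ _ _ _; rewrite -[leLHS](_ : \int[P]_x (cst 0 x) = _).
    by rewrite Rint_cst ltW.
  by apply: eq_Rintegral => x _; rewrite /= subrr normr0.
have [d1 d10 H1] := kstep_cont (kodo_L1 d0 kW Ls s0 n)
  (kodo_ge0 d0 kW s0 n) (kodo_int P W sigma n) (smooth n) eps0.
have [d2 d20 H2] := IH _ d10.
exists (Num.min d1 d2); first by rewrite lt_min d10 d20.
move=> W' sigma' kW' cW' Ls' s'0 ss.
have m1 : Num.min d1 d2 <= d1 by rewrite ge_min lexx.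
have m2 : Num.min d1 d2 <= d2 by rewrite ge_min lexx orbT.
have cut1 : kcut P W W' d1 by move=> A B mA mB; apply: le_trans m1; exact: cW'.
have cut2 : kcut P W W' d2 by move=> A B mA mB; apply: le_trans m2; exact: cW'.
apply: (H1 W' sigma' (kodo P W' sigma' n)) => //.
- exact: le_trans m1.
- exact: (kodo_L1 d0 kW').
- exact: (kodo_ge0 d0 kW').
- apply: H2 => //; exact: le_trans m2.
Qed.

End odometer_continuity.

(** * Continuity of the activity for kernels *)

Section activity_continuity.
Context (disp : measure_display) (T : measurableType disp) (R : realType).
Variable P : probability T R.
Local Notation L1 f := (P.-integrable setT (EFin \o f)).

(** The limit is that of the bounded configuration after one update; the first firing and the index
    shift disappear after division by [n]. *)
Lemma kactivity (d : R) (W : T -> T -> R) (sigma : T -> R) : 0 < d ->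
  degkernel P d W -> kconnected P W -> kseparable P W ->
  L1 sigma -> (forall x, 0 <= sigma x) ->
  let u := kodo P W (kconfig1 P W sigma) in
  exists a : R,
  [/\ forall x, kodo P W sigma n x / n%:R @[n --> \oo] --> a,
      forall eps, 0 < eps -> exists N, forall n x, (N <= n)%N ->
        `|u n x / n%:R - a| <= eps,
      forall n (k : R), (0 < n)%N -> (forall x, u n x <= k) -> a <= k / n%:R &
      forall n (k : R), (0 < n)%N -> (forall x, k <= u n x) -> k / n%:R <= a].
Proof.
move=> d0 kW cW sW Ls s0 u.
have [a [a1 a2 a3]] := kodo_activity d0 kW cW sW
  (L1_measurable (kconfig1_L1 d0 kW Ls s0)) (kconfig1_ge0 d0 kW Ls s0)
  (kconfig1_le d0 kW Ls s0).
exists a; split => // x; apply/cvgrPdist_le => eps eps0.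
have e2 : 0 < eps / 2 by rewrite divr_gt0.
have [N HN] := a1 _ e2.
pose b := kodo P W sigma 1 x + `|a|.
have b0 : 0 <= b by rewrite addr_ge0// (kodo_ge0 d0 kW s0).
pose M := maxn N (Num.bound (b / (eps / 2))).
exists M.+1 => // -[//|n] Mn; have {}Mn : (M <= n)%N := Mn.
cbv beta; rewrite distrC (kodo_shift d0 kW Ls s0).
have n0 : 0 < n.+1%:R :> R by rewrite ltr0n.
rewrite -[X in _ - X](mulfK (lt0r_neq0 n0)) -mulrBl normrM.
rewrite [X in _ * X]ger0_norm ?invr_ge0// ler_pdivrMr//.
have Nn : (N <= n)%N by apply: leq_trans Mn; exact: leq_maxl.
have h1 : b <= eps / 2 * n%:R.
  rewrite mulrC -ler_pdivrMr//; apply: (@le_trans _ _ (Num.bound (b / (eps / 2)))%:R).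
    by apply/ltW; apply: le_lt_trans (archi_boundP _); rewrite ?ler_norm// divr_ge0// ltW.
  by rewrite ler_nat (leq_trans (leq_maxr _ _) Mn).
have h2 : `|u n x - n%:R * a| <= eps / 2 * n%:R.
  case: n {Mn h1} n0 Nn => [_ _|n n0 Nn].
    by rewrite mul0r mulr0 subr0 /u /= normr0.
  have n1 : 0 < n.+1%:R :> R by rewrite ltr0n.
  have := HN _ x Nn; rewrite -/(u _ x).
  rewrite -[X in _ - X](mulfK (lt0r_neq0 n1)) -mulrBl normrM.
  by rewrite [X in _ * X]ger0_norm ?invr_ge0// ler_pdivrMr// [a * _]mulrC.
rewrite -/(u n x) (_ : _ - _ = (kodo P W sigma 1 x - a) + (u n x - n%:R * a)); last first.
  by rewrite -natr1; ring.
apply: (le_trans (ler_normD _ _)).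
have h3 : `|kodo P W sigma 1 x - a| <= b.
  rewrite (le_trans (ler_normB _ _))// /b lerD2r ger0_norm//.
  exact: (kodo_ge0 d0 kW s0).
rewrite -natr1; lra.
Qed.

Theorem kactivity_continuous (d : R) (W : T -> T -> R) (sigma : T -> R) : 0 < d ->
  degkernel P d W -> kconnected P W -> kseparable P W ->
  L1 sigma -> (forall x, 0 <= sigma x) ->
  (forall n, P.-negligible [set x |
    (sigma x + kop P W (kodo P W sigma n) x) / kdeg P W x \is a Num.int]) ->
  exists2 a : R, (forall x, kodo P W sigma n x / n%:R @[n --> \oo] --> a) &
  forall eps, 0 < eps -> exists2 delta, 0 < delta &
  forall W' sigma', degkernel P d W' -> kconnected P W' -> kseparable P W' ->
    kcut P W W' delta -> L1 sigma' -> (forall x, 0 <= sigma' x) ->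
    \int[P]_x `|sigma x - sigma' x| <= delta ->
  exists2 a' : R, (forall x, kodo P W' sigma' n x / n%:R @[n --> \oo] --> a') &
    `|a - a'| < eps.
Proof.
move=> d0 kW cW sW Ls s0 smooth.
have [a [cva a1 a2 a3]] := kactivity d0 kW cW sW Ls s0.
exists a => // eps eps0.
set tau := kconfig1 P W sigma in a1 a2 a3.
have t0 := kconfig1_ge0 d0 kW Ls s0; have Lt := kconfig1_L1 d0 kW Ls s0.
rewrite -/tau in t0 Lt.
have a0 : 0 <= a.
  rewrite -(mul0r (1%:R)^-1); apply: (a3 1%N) => // x; exact: (kodo_ge0 d0 kW t0).
(* [C] bounds [tau'] for every [sigma'] within distance 1 of [sigma]. In [K], the 2 is the L^1
   distance of the odometers [u] and [u'], and the final 1 is lost to the floor. *)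
pose C := 1 + (\int[P]_x sigma x + 1) / d.
pose K := (C + 2) / d + 1.
have C0 : 0 <= C.
  by rewrite /C addr_ge0// divr_ge0// ?(ltW d0)// addr_ge0//; exact: Rint_ge0.
have K0 : 0 <= K by rewrite /K addr_ge0// divr_ge0// ?(ltW d0)// addr_ge0.
have e4 : 0 < eps / 4 by rewrite divr_gt0.
have [N HN] := a1 _ e4.
(* Time [n] is late enough for the error [K], and for the [a] due to bounds taken at time [n.+1], to
   cost at most [eps / 2] per step. *)
have [n [Nn nK n_gt0]] : exists n, [/\ (N <= n)%N, K + a + 1 <= n%:R * (eps / 2) & (0 < n)%N].
  pose M := Num.bound ((K + a + 1) / (eps / 2)).
  exists (maxn N M).+1; split => //; first exact/leqW/leq_maxl.
  rewrite -ler_pdivrMr ?divr_gt0//; apply: (@le_trans _ _ M%:R).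
    apply/ltW; apply: le_lt_trans (archi_boundP _); rewrite ?ler_norm//.
    rewrite divr_ge0 ?ltW ?divr_gt0//.
    lra.
  by rewrite ler_nat leqW// leq_maxr.
have [d1 d10 H1] := kodo_cont d0 kW Ls s0 smooth n.+1 ltr01.
have [d2 d20 H2] := kodo_cont d0 kW Ls s0 smooth 1 ltr01.
pose delta := Num.min 1 (Num.min d1 d2).
have de1 : delta <= 1 by rewrite ge_min lexx.
have ded1 : delta <= d1 by rewrite !ge_min lexx !orbT.
have ded2 : delta <= d2 by rewrite !ge_min lexx !orbT.
exists delta; first by rewrite !lt_min ltr01 d10 d20.
move=> W' sigma' kW' cW' sW' cut Ls' s'0 ss.
have [a' [cva' _ a2' a3']] := kactivity d0 kW' cW' sW' Ls' s'0.
exists a' => //.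
set tau' := kconfig1 P W' sigma' in a2' a3'.
have t'0 := kconfig1_ge0 d0 kW' Ls' s'0; have Lt' := kconfig1_L1 d0 kW' Ls' s'0.
have t'C := kconfig1_le d0 kW' Ls' s'0.
rewrite -/tau' in t'0 Lt' t'C.
pose u := kodo P W tau n; pose u' := kodo P W' tau' n.
have Lu : L1 u by exact: (kodo_L1 d0 kW).
have Lu' : L1 u' by exact: (kodo_L1 d0 kW').
have cut' e : delta <= e -> kcut P W W' e.
  by move=> de A B mA mB; apply: le_trans de; exact: cut.
(* By [kodo_shift], [u] and [u'] are differences of the original odometers at times [n.+1] and 1,
   each pair being within 1. *)
have uu : \int[P]_x `|u x - u' x| <= 2.
  have L m : L1 (fun x => `|kodo P W sigma m x - kodo P W' sigma' m x|).
    by apply/L1norm/L1B; [exact: (kodo_L1 d0 kW)|exact: (kodo_L1 d0 kW')].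
  apply: (@le_trans _ _ (\int[P]_x (`|kodo P W sigma n.+1 x - kodo P W' sigma' n.+1 x|
     + `|kodo P W sigma 1 x - kodo P W' sigma' 1 x|))).
    apply: Rint_le; [exact/L1norm/L1B|exact: L1D|move=> x].
    rewrite (kodo_shift d0 kW Ls s0) (kodo_shift d0 kW' Ls' s'0).
    rewrite -/tau -/tau' -/(u x) -/(u' x).
    set p := kodo P W _ 1 x; set p' := kodo P W' _ 1 x.
    rewrite (_ : u x - u' x = (p + u x - (p' + u' x)) - (p - p')); last by ring.
    exact: ler_normB.
  rewrite RintD// (_ : 2 = 1 + 1)//; apply: lerD.
    by apply: H1 => //; [exact: cut'|exact: le_trans ded1].
  by apply: H2 => //; [exact: cut'|exact: le_trans ded2].
have s'C : 1 + (\int[P]_x sigma' x) / d <= C.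
  rewrite /C lerD2l ler_pM2r ?invr_gt0// -lerBlDl -RintB//.
  apply: (@le_trans _ _ (\int[P]_x `|sigma x - sigma' x|)); last exact: le_trans de1.
  apply: Rint_le; [exact: L1B|exact/L1norm/L1B|move=> x].
  by rewrite distrC ler_norm.
have n0 : 0 < n%:R :> R by rewrite ltr0n.
(* Since [W' <= 1], the operator turns L^1 closeness into a pointwise bound; the next step then
   bounds the odometer uniformly. *)
have ku x : `|kop P W' u x - kop P W' u' x| <= 2.
  rewrite -(kopB kW')//; apply: le_trans uu; apply: (kop_norm kW'); exact: L1B.
have u_le x : u x <= n%:R * (a + eps / 4).
  have := HN n x Nn; rewrite ler_norml => /andP[_].
  by rewrite lerBlDr ler_pdivrMr// -/u mulrC addrC.
have u_ge x : n%:R * (a - eps / 4) <= u x.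
  have := HN n x Nn; rewrite ler_norml => /andP[+ _].
  by rewrite lerBrDr ler_pdivlMr// -/u mulrC addrC.
have D0 x := kdeg_gt0 d0 kW' x.
have Dd x : (kdeg P W' x)^-1 <= d^-1 by rewrite lef_pV2 ?posrE// (kdeg_ge kW').
have up x : kodo P W' tau' n.+1 x <= n%:R * (a + eps / 4) + K.
  apply: (le_trans (kstep_le P W' tau' u' x)).
  have h1 : kop P W' u x <= n%:R * (a + eps / 4) * kdeg P W' x.
    by rewrite -(kop_cst kW'); apply: (kop_le kW') => //; exact: L1_cst.
  have h2 := ku x; rewrite ler_norml in h2; case/andP: h2 => h2 h3.
  have h4 : tau' x + kop P W' u' x <=
      (C + 2) + n%:R * (a + eps / 4) * kdeg P W' x.
    by have tx := t'C x; clear -tx h1 h2 s'C; lra.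
  apply: (@le_trans _ _ (((C + 2) + n%:R * (a + eps / 4) * kdeg P W' x) / kdeg P W' x)).
    by rewrite ler_wpM2r// invr_ge0 ltW.
  rewrite mulrDl mulfK ?gt_eqF// addrC lerD2l /K.
  apply: (@le_trans _ _ ((C + 2) / d)); last by rewrite lerDl.
  by rewrite ler_wpM2l// addr_ge0.
have low x : n%:R * (a - eps / 4) - K <= kodo P W' tau' n.+1 x.
  apply: le_trans (ltW (kstep_gt P W' tau' u' x)).
  have h1 : n%:R * (a - eps / 4) * kdeg P W' x <= kop P W' u x.
    by rewrite -(kop_cst kW'); apply: (kop_le kW') => //; exact: L1_cst.
  have h2 := ku x; rewrite ler_norml in h2; case/andP: h2 => h2 h3.
  have h4 : n%:R * (a - eps / 4) * kdeg P W' x - (C + 2) <= tau' x + kop P W' u' x.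
    by have tx := t'0 x; clear -tx h1 h3 C0; lra.
  have h5 : (C + 2) / kdeg P W' x <= (C + 2) / d.
    by rewrite ler_wpM2l// addr_ge0.
  have h6 : (n%:R * (a - eps / 4) * kdeg P W' x - (C + 2)) / kdeg P W' x <=
     (tau' x + kop P W' u' x) / kdeg P W' x.
    by rewrite ler_wpM2r// invr_ge0 ltW.
  move: h6; rewrite mulrBl mulfK ?gt_eqF// /K.
  by clear -h5; lra.
have n1 : 0 < n.+1%:R :> R by rewrite ltr0n.
have := a2' n.+1 _ isT up; have := a3' n.+1 _ isT low.
rewrite ler_pdivrMr// ler_pdivlMr//.
have nS : n.+1%:R = n%:R + 1 :> R by rewrite natr1.
rewrite nS => h1 h2.
have g1 : (a - a') * n.+1%:R < eps * n.+1%:R.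
  by rewrite nS; clear -h1 h2 nK eps0 a0 n0; lra.
have g2 : (a' - a) * n.+1%:R < eps * n.+1%:R.
  by rewrite nS; clear -h1 h2 nK eps0 a0 n0; lra.
move: g1 g2; rewrite !ltr_pM2r// => g1 g2.
by rewrite ltr_norml; apply/andP; split; clear -g1 g2; lra.
Qed.

End activity_continuity.

(** * Borel versions of graphons *)

Section integral_ae_eq_nonmeasurable.
Local Open Scope ereal_scope.
Context (disp : measure_display) (T : measurableType disp) (R : realType).
Variable mu : {measure set T -> \bar R}.
Import HBNNSimple.

(** A simple function below [f], set to 0 on the null set, lies below [g] and keeps its integral. *)
Let le_integral_ae_eq (f g : T -> \bar R) : (forall x, 0 <= f x) ->
  (forall x, 0 <= g x) -> {ae mu, forall x, f x = g x} ->
  \int[mu]_x f x <= \int[mu]_x g x.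
Proof.
move=> f0 g0 [N [mN N0 fgN]].
rewrite !ge0_integralTE//; apply/ge_ereal_sup => /= _ [h hf <-].
pose h' := proj_nnsfun h (measurableC mN).
apply: ereal_sup_ubound; exists h'.
  move=> x; rewrite /h' /= mindicE; have [xN|xN] := boolP (x \in ~` N).
    rewrite mulr1 (le_trans (hf x))//.
    suff -> : f x = g x by [].
    apply: contrapT => fg; move: xN; rewrite inE; apply; exact: fgN.
  by rewrite mulr0.
rewrite -!integralT_nnsfun; apply: ge0_ae_eq_integral => //.
- by apply/measurable_EFinP; exact: measurable_funPT.
- by apply/measurable_EFinP; exact: measurable_funPT.
- by move=> x _; rewrite lee_fin.
- by move=> x _; rewrite lee_fin.
exists N; split => // x; apply: contra_notP => xN _.
  by rewrite /h' /= mindicE mem_set// mulr1.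
Qed.

(* The integral is a supremum over simple functions, so no measurability is
   needed here. *)
Lemma integral_ae_eq_gen (f g : T -> \bar R) : {ae mu, forall x, f x = g x} ->
  \int[mu]_x f x = \int[mu]_x g x.
Proof.
move=> fg; rewrite integralE [RHS]integralE; congr (_ - _); apply/eqP;
  rewrite eq_le; apply/andP; split; apply: le_integral_ae_eq => //;
  by apply: filterS fg => x; rewrite ?funeposE ?funenegE => ->.
Qed.

Lemma Rintegral_ae_eq_gen (f g : T -> R) : {ae mu, forall x, f x = g x} ->
  (\int[mu]_x f x = \int[mu]_x g x)%R.
Proof.
move=> fg; congr fine; apply: integral_ae_eq_gen.
by apply: filterS fg => x ->.
Qed.

End integral_ae_eq_nonmeasurable.

(* Unlike [filterS] and [filterS2], these two unify through [measurableTypeR R]. *)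
Lemma ae_imply (disp : measure_display) (T : measurableType disp) (R : realType)
    (mu : {measure set T -> \bar R}) (Q1 Q2 : T -> Prop) :
  (forall x, Q1 x -> Q2 x) -> {ae mu, forall x, Q1 x} -> {ae mu, forall x, Q2 x}.
Proof. by move=> Q12; apply: filterS. Qed.

Lemma ae_imply2 (disp : measure_display) (T : measurableType disp) (R : realType)
    (mu : {measure set T -> \bar R}) (Q1 Q2 Q3 : T -> Prop) :
  (forall x, Q1 x -> Q2 x -> Q3 x) -> {ae mu, forall x, Q1 x} ->
  {ae mu, forall x, Q2 x} -> {ae mu, forall x, Q3 x}.
Proof. by move=> Q12; apply: filterS2. Qed.

(** * Lebesgue measure of the unit interval as a probability *)

Section unit_lebesgue.
Context {R : realType}.

(** The measure still lives on the whole line, so total functions fit the kernel theory without a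
    subtype. *)
Definition unit_leb : set (measurableTypeR R) -> \bar R :=
  mrestr (@lebesgue_measure R) (measurable_itv `[0, 1]).

HB.instance Definition _ := Measure.on unit_leb.

Let unit_leb_setT : unit_leb setT = 1%E.
Proof.
by rewrite /unit_leb /mrestr setTI lebesgue_measure_itv/= lte_fin ltr01 oppr0 adde0.
Qed.

HB.instance Definition _ :=
  Measure_isProbability.Build _ _ _ unit_leb unit_leb_setT.

Local Notation leb := (@lebesgue_measure R).
Definition uleb := (unit_leb : probability _ _).

Lemma unit_itv_measurable : measurable (@unit_itv R).
Proof. exact: measurable_itv. Qed.

Lemma ae_uleb (Q : R -> Prop) :
  {ae uleb, forall x, Q x} <-> {ae leb, forall x, unit_itv x -> Q x}.
Proof.
have mI := unit_itv_measurable; split=> -[N [mN N0 QN]].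
  exists (N `&` unit_itv); split => //; first exact: measurableI.
  move=> x /= /not_implyP[Ix nQ]; split => //; exact: QN.
exists (N `|` ~` unit_itv); split; first exact/measurableU/measurableC.
  rewrite /uleb/= /unit_leb /mrestr setIUl setICl setU0.
  apply: (@subset_measure0 _ _ _ leb _ N) => //.
  exact: measurableI.
move=> x /= nQ; have [Ix|] := pselect (unit_itv x); last by right.
by left; apply: QN => /= /(_ Ix).
Qed.

Lemma uleb_ae_itv : {ae uleb, forall x, unit_itv x}.
Proof. by apply/ae_uleb; exact: aeW. Qed.

Lemma integral_uleb (f : R -> \bar R) :
  (\int[leb]_(x in unit_itv) f x = \int[uleb]_x f x)%E.
Proof.
rewrite (@eq_measure_integral _ _ _ _ uleb); last first.
  by move=> A mA /setIidl {1}<-.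
rewrite integral_mkcond; apply: integral_ae_eq_gen.
by apply: (ae_imply _ uleb_ae_itv) => x Ix; rewrite patchE mem_set.
Qed.

Lemma Rintegral_uleb (f : R -> R) :
  \int[leb]_(x in unit_itv) f x = \int[uleb]_x f x.
Proof. by congr fine; exact: integral_uleb. Qed.

Lemma deg_uleb (W : R -> R -> R) (x : R) : deg W x = kdeg uleb W x.
Proof. exact: Rintegral_uleb. Qed.

End unit_lebesgue.

(** * Borel versions of Lebesgue measurable functions *)

Section borel_version.
Context (disp : measure_display) (T : measurableType disp) (R : realType).
Variable mu : {measure set T -> \bar R}.

(** The positive part of [f] is the supremum of the rationals [q >= 0] below [f], or 0. Each set
    [q < f] is Borel up to a null set, so replacing these sets by Borel ones changes the supremum on
    a countable union of null sets only. *)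
Lemma completed_borel_version (D : set T) (f : T -> R) :
  completed_measurable_fun mu D f ->
  exists g : T -> R, [/\ measurable_fun setT g, forall x, 0 <= g x &
    {ae mu, forall x, D x -> g x = Num.max (f x) 0}].
Proof.
move=> cf.
(* An enumeration of the non-negative rationals; other codes give 0, harmless in a supremum of
   non-negative terms. *)
pose q (n : nat) : R := Num.max 0 (ratr (odflt 0 (unpickle n : option rat))).
have q0 n : 0 <= q n by rewrite /q le_max lexx.
have /choice[B hB] : forall n, exists B : set T, measurable B /\
    exists2 N, mu.-negligible N & B `|` N = D `&` f @^-1` `]q n, +oo[.
  move=> n; have [B mB [N nN BN]] := cf `]q n, +oo[%classic (measurable_itv _).
  by exists B; split => //; exists N.
pose h n x : R := q n * \1_(B n) x.
have h0 n x : 0 <= h n x by rewrite mulr_ge0.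
pose g' x := esups (fun n => (h n x)%:E) 0.
have mg' : measurable_fun setT g'.
  apply: (@measurable_fun_esups _ _ _ setT (fun n x => (h n x)%:E)) => n.
  apply/measurable_EFinP/measurable_funM => //.
  by apply: measurable_indic; case: (hB n).
have g'0 x : (0 <= g' x)%E.
  apply: (@le_trans _ _ (h 0%N x)%:E); first by rewrite lee_fin.
  by apply: ereal_sup_ubound; exists 0%N.
exists (fine \o g'); split.
- by apply: measurableT_comp => //; exact: fine_measurable.
- by move=> x; rewrite fine_ge0.
have /choice[N hN] : forall n, exists N : set T, mu.-negligible N /\
    B n `|` N = D `&` f @^-1` `]q n, +oo[.
  by move=> n; have [_ [N nN BN]] := hB n; exists N.
apply: (@negligibleS _ _ _ mu (\bigcup_n N n)); last first.
  by apply: negligible_bigcup => n; case: (hN n).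
move=> x /= /not_implyP[Dx gx]; apply: contrapT => xN; apply: gx.
have Bx n : \1_(B n) x = (q n < f x)%R%:R :> R.
  have [_ E] := hN n; rewrite indicE; congr (nat_of_bool _)%:R.
  apply/idP/idP => [|qf].
    rewrite inE => Bnx; have : (B n `|` N n) x by left.
    by rewrite E /= in_itv/= andbT => -[].
  have : (B n `|` N n) x by rewrite E; split => //=; rewrite in_itv/= andbT.
  by case=> [|Nnx]; [rewrite inE|exfalso; apply: xN; exists n].
suff -> : g' x = (Num.max (f x) 0)%:E by [].
apply/eqP; rewrite eq_le; apply/andP; split.
  apply: ge_ereal_sup => _ [n _ <-]; rewrite lee_fin /h Bx.
  have [qf|_] := ltP (q n) (f x); first by rewrite mulr1 le_max ltW.
  by rewrite mulr0 le_max lexx orbT.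
have [fx0|fx0] := leP (f x) 0; first by rewrite ?max_r ?max_l.
rewrite ?max_l ?(ltW fx0)//.
apply/lee_addgt0Pr => e e0.
have : Num.max 0 (f x - e) < f x by rewrite gt_max fx0 ltrBlDr ltrDl.
move=> /rat_in_itvoo[r]; rewrite in_itv/= => /andP[r1 r2].
have qr : q (pickle r) = ratr r.
  rewrite /q pickleK /= max_r//; apply: le_trans (ltW r1).
  by rewrite le_max lexx.
apply: (@le_trans _ _ (ratr r + e)%:E).
  rewrite lee_fin -lerBlDr; apply: le_trans (ltW r1).
  by rewrite le_max lexx orbT.
rewrite EFinD leeD2r//; apply: ereal_sup_ubound; exists (pickle r) => //.
by rewrite /h Bx qr r2 mulr1.
Qed.

End borel_version.

(** * Null sets of a product measure *)

Section product_null_sets.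
Local Open Scope ereal_scope.
Context (d1 d2 : measure_display) (T1 : measurableType d1)
  (T2 : measurableType d2) (R : realType).
Variable m1 : {sigma_finite_measure set T1 -> \bar R}.
Variable m2 : {sigma_finite_measure set T2 -> \bar R}.

(** The product measure is the integral of the measures of the sections, and a non-negative integral
    vanishes exactly when the integrand does a.e. *)
Lemma prod_null_xsection (N : set (T1 * T2)) : measurable N ->
  (m1 \x m2) N = 0 <-> {ae m1, forall x, m2 (xsection N x) = 0}.
Proof.
move=> mN.
have mx : measurable_fun setT (m2 \o xsection N) by exact: measurable_fun_xsection.
have E : \int[m1]_x `|(m2 \o xsection N) x| = (m1 \x m2) N.
  by apply: eq_integral => x _ /=; rewrite gee0_abs.
have [H1 H2] := ae_eq_integral_abs m1 measurableT mx.
rewrite -E; split=> [/H1|h]; first by apply: filterS => x /(_ Logic.I).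
by apply: H2; apply: filterS h => x /= hx _.
Qed.

Lemma prod_null_ysection (N : set (T1 * T2)) : measurable N ->
  (m1 \x m2) N = 0 -> {ae m2, forall y, m1 (ysection N y) = 0}.
Proof.
move=> mN N0.
have my : measurable_fun setT (m1 \o ysection N) by exact: measurable_fun_ysection.
have E : \int[m2]_y `|(m1 \o ysection N) y| = 0.
  rewrite -N0 /product_measure1 -(indic_fubini_tonelli_FE m2 mN).
  rewrite (indic_fubini_tonelli m1 m2 mN) (indic_fubini_tonelli_GE m1 mN).
  by apply: eq_integral => x _ /=; rewrite gee0_abs.
have [H1 _] := ae_eq_integral_abs m2 measurableT my.
by apply: filterS (H1 E) => x /(_ Logic.I).
Qed.

End product_null_sets.

(** * Kernels representing graphons *)

Section graphon_kernel.
Context {R : realType}.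
Local Notation leb := (@lebesgue_measure R).
Local Notation leb2 := (@lebesgue_measure R \x @lebesgue_measure R)%E.
Local Notation T := (measurableTypeR R).
Local Notation P := (@uleb R).

Definition borel_version (W : R -> R -> R) (g : T * T -> R) : Prop :=
  [/\ measurable_fun setT g, forall z, 0 <= g z &
    {ae leb2, forall z, (unit_itv `*` unit_itv) z -> g z = W z.1 z.2}].

Lemma graphon_borel_version (W : R -> R -> R) : is_graphon W ->
  exists g, borel_version W g.
Proof.
move=> [cW _ W01]; have [g [mg g0 gW]] := completed_borel_version cW.
exists g; split => //; apply: (ae_imply _ gW) => -[x y] /= h /= xy.
rewrite h// max_l//; case: xy => /= Ix Iy.
by case/andP: (W01 x y Ix Iy).
Qed.

(** Null sets are sliced in both directions; symmetry of [W] identifies the second slice with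
    [W x y], as symmetrising [g] requires. *)
Lemma borel_version_sections (W : R -> R -> R) g : is_graphon W ->
  borel_version W g ->
  {ae P, forall x, {ae P, forall y, g (x, y) = W x y /\ g (y, x) = W x y}}.
Proof.
move=> [_ symW _] [mg _ [N [mN N0 gN]]].
have nx := (prod_null_xsection leb leb mN).1 N0.
have ny := prod_null_ysection mN N0.
apply/ae_uleb; apply: (ae_imply2 _ nx ny) => x xN yN Ix.
apply/ae_uleb.
have /= mx := measurable_xsection x mN; have /= my := measurable_ysection x mN.
exists (xsection N x `|` ysection N x); split; first exact: measurableU.
  exact: null_set_setU.
move=> y /= /not_implyP[Iy ng]; apply: contrapT => nN; apply: ng.
move/not_orP: nN => [n1 n2]; split; apply: contrapT => ng.
  by apply: n1; rewrite /xsection /= inE; apply: gN => /= /(_ (conj Ix Iy)).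
apply: n2; rewrite /ysection /= inE; apply: gN => /= /(_ (conj Iy Ix)).
by rewrite symW.
Qed.

(** [W1] symmetrises the Borel version and caps it at 1; [W0] then repairs the null set of points
    whose degree is below [d]. *)
Lemma graphon_degkernel (d : R) (W : R -> R -> R) : 0 < d -> is_graphon W ->
  (d%:E <= mindeg W)%E ->
  exists2 W0 : R -> R -> R, degkernel P d W0 &
    {ae P, forall x, {ae P, forall y, W x y = W0 x y}}.
Proof.
move=> d0 gW dW; have [g bg] := graphon_borel_version gW.
have sg := borel_version_sections gW bg.
have [_ symW W01] := gW; have [mg g0 _] := bg.
pose W1 (x y : T) : R := Num.min 1 ((g (x, y) + g (y, x)) / 2).
have W1_01 x y : 0 <= W1 x y <= 1.
  rewrite /W1 ge_min lexx andbT le_min ler01 divr_ge0// addr_ge0//; exact: g0.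
have mW1 : measurable_fun setT (fun z : T * T => W1 z.1 z.2).
  apply: measurable_minr => //; apply: measurable_funM => //.
  apply: measurable_funD.
    by apply: eq_measurable_fun mg => -[x y].
  rewrite (_ : (fun z : T * T => g (z.2, z.1)) = g \o (fun z => (z.2, z.1)))//.
  by apply: measurableT_comp => //; exact: measurable_fun_pair.
have WW1 : {ae P, forall x, {ae P, forall y, W x y = W1 x y}}.
  apply: (ae_imply2 _ sg uleb_ae_itv) => x hx Ix.
  apply: (ae_imply2 _ hx uleb_ae_itv) => y [gxy gyx] Iy.
  rewrite /W1 gxy gyx min_r; last by case/andP: (W01 x y Ix Iy); lra.
  lra.
have kW1 : degkernel P 0 W1.
  split => //; first by move=> x y; rewrite /W1 addrC.
  by move=> x; apply: Rint_ge0 => y; case/andP: (W1_01 x y).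
have dW1 : {ae P, forall x, d <= kdeg P W1 x}.
  have /ess_infP dW' := dW.
  have dW2 : {ae P, forall x, d <= deg W x} by apply: (ae_imply _ dW').
  apply: (ae_imply2 _ dW2 WW1) => x; rewrite deg_uleb => dx hx.
  by rewrite /kdeg -(Rintegral_ae_eq_gen hx).
(* Degrees are at most 1, so otherwise the degree bound would fail everywhere. Hence degree 1
   suffices at a bad point. *)
have d1 : d <= 1.
  have [N [mN N0 hN]] := dW1.
  apply: contrapT => /negP; rewrite -ltNge => d1.
  have : P setT = 0%E.
    rewrite -N0; congr (P _); apply/esym; rewrite -subTset => x _.
    apply: hN => /= dx; have := kdeg_le1 kW1 x; lra.
  have -> : P setT = 1%E by exact: probability_setT.
  by move/eqP; rewrite onee_eq0.
pose bad : set T := [set x | kdeg P W1 x < d].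
have mbad : measurable bad.
  rewrite /bad -[X in measurable X]setTI.
  by apply: (measurable_fun_ltr (measurable_kdeg kW1) (measurable_cst d) measurableT).
have aebad : {ae P, forall x, ~ bad x}.
  by apply: (ae_imply _ dW1) => x dx /=; apply/negP; rewrite -leNgt.
(* Raising the row and the column of each bad point to 1 keeps symmetry, gives that point degree 1,
   and alters the other rows on a null set. *)
pose W0 (x y : T) : R := Num.max (W1 x y) (Num.max (\1_bad x) (\1_bad y)).
have i01 x : 0 <= (\1_bad x : R) <= 1.
  by rewrite indicE; case: (_ \in _); rewrite ?lexx ?ler01.
have W1W0 x : ~ bad x -> {ae P, forall y, W1 x y = W0 x y}.
  move=> nx; apply: (ae_imply _ aebad) => y ny.
  rewrite /W0 !indicE !memNset// maxxx max_l//.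
  by case/andP: (W1_01 x y).
exists W0; last first.
  apply: (ae_imply2 _ WW1 aebad) => x hx nx.
  by apply: (ae_imply2 _ hx (W1W0 x nx)) => y -> ->.
split.
- apply: measurable_maxr => //; apply: measurable_maxr.
    apply: (@measurableT_comp _ _ _ _ _ _ (\1_bad : T -> R) _ (fun z : T * T => z.1)).
      exact: measurable_indic.
    exact: measurable_fst.
  apply: (@measurableT_comp _ _ _ _ _ _ (\1_bad : T -> R) _ (fun z : T * T => z.2)).
    exact: measurable_indic.
  exact: measurable_snd.
- by move=> x y; rewrite /W0 maxC [X in Num.max X _]maxC maxC; case: kW1 => _ ->.
- move=> x y; case/andP: (W1_01 x y) => h1 h2; case/andP: (i01 x) => h3 h4.
  by case/andP: (i01 y) => h5 h6; rewrite /W0 le_max h1 /= !ge_max h2 h4 h6.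
- move=> x; have [bx|bx] := pselect (bad x); last first.
    rewrite /kdeg -(Rintegral_ae_eq_gen (W1W0 x bx)) leNgt.
    exact/negP.
  rewrite /kdeg (_ : \int[P]_y _ = \int[P]_y (cst 1 y)); first by rewrite Rint_cst.
  apply: eq_Rintegral => y _; rewrite /W0 indicE mem_set//.
  rewrite max_r; first by rewrite max_l//; case/andP: (i01 y).
  by rewrite le_max; case/andP: (W1_01 x y) => _ ->.
Qed.

End graphon_kernel.

(** * Rational step functions and separability *)

Section step_functions.
Context {R : realType}.
Local Notation leb := (@lebesgue_measure R).
Local Notation T := (measurableTypeR R).
Local Notation P := (@uleb R).

(** Heine-Cantor: a subsequence of the first coordinates of bad pairs converges, and continuity at
    its limit contradicts the gap [eps]. *)
Lemma unif_continuous_unit_itv (g : R -> R) : continuous g -> forall eps, 0 < eps ->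
  exists m : nat, forall x y, unit_itv x -> unit_itv y ->
    `|x - y| <= m.+1%:R^-1 -> `|g x - g y| <= eps.
Proof.
move=> cg eps eps0; apply: contrapT => nh.
have /choice[xy hxy] : forall m, exists p : R * R, [/\ unit_itv p.1, unit_itv p.2,
    `|p.1 - p.2| <= m.+1%:R^-1 & eps < `|g p.1 - g p.2|].
  move=> m; apply: contrapT => hm; apply: nh; exists m => x y Ix Iy xy.
  by rewrite leNgt; apply/negP => h; apply: hm; exists (x, y).
have bx : bounded_fun (fun m => (xy m).1).
  exists 1; split; first exact: num_real.
  move=> M M1 m _ /=; have [+ _ _ _] := hxy m.
  rewrite /unit_itv /= in_itv /= => /andP[h1 h2].
  by rewrite ger0_norm// (le_trans h2)// ltW.
have [f incf cvf] := bolzano_weierstrass bx.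
have jf j : (j <= f j)%N.
  elim: j => // j IH; apply: (leq_ltn_trans IH).
  by have /increasing_seqP := incf; apply.
set l := lim _ in cvf.
have e3 : 0 < eps / 3 by rewrite divr_gt0.
have /cvgrPdist_le /(_ _ e3) [r /= r0 hr] := cg l.
have r2 : 0 < r / 3 by rewrite divr_gt0.
have /cvgrPdist_le /(_ _ r2) [N1 _ HN1] := cvf.
have /cvgrPdist_le /(_ _ r2) [N2 _ HN2] := @cvg_harmonic R.
pose j := maxn N1 N2.
have h1 := HN1 j (leq_maxl _ _); have h2 := HN2 j (leq_maxr _ _).
have [_ _ h3 h4] := hxy (f j).
rewrite /= in h1.
have h5 : `|(xy (f j)).1 - (xy (f j)).2| <= r / 3.
  apply: (le_trans h3); move: h2; rewrite sub0r normrN /harmonic /=.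
  rewrite ger0_norm ?invr_ge0// => h2; apply: le_trans h2.
  by rewrite lef_pV2 ?posrE ?ltr0n// ler_nat ltnS.
have h6 : `|g l - g (xy (f j)).1| <= eps / 3.
  by apply: hr => /=; apply: (le_lt_trans h1); lra.
have h7 : `|g l - g (xy (f j)).2| <= eps / 3.
  apply: hr => /=.
  rewrite (_ : l - _ = (l - (xy (f j)).1) + ((xy (f j)).1 - (xy (f j)).2)); last by ring.
  by apply: (le_lt_trans (ler_normD _ _)); lra.
have := ler_normB (g l - g (xy (f j)).2) (g l - g (xy (f j)).1).
rewrite (_ : g l - g (xy (f j)).2 - _ = g (xy (f j)).1 - g (xy (f j)).2); last by ring.
by lra.
Qed.

(** Cells of length [1 / m] with rational values listed in [l]: the parameters form a countable
    type, which is the point of the encoding. *)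
Definition stepf (m : nat) (l : seq rat) (y : R) : R :=
  ratr (nth 0 l `|Num.floor (y * m%:R)|%N).

Lemma measurable_stepf m l : measurable_fun setT (stepf m l : T -> R).
Proof.
move=> _ Y mY; rewrite setTI.
pose F (y : T) : R := (Num.floor (y * m%:R))%:~R.
have mF : measurable_fun setT F.
  by apply: measurable_floor; apply: measurable_funM.
rewrite (_ : _ @^-1` _ =
  \bigcup_(n in [set n | Y (ratr (nth 0 l n))]) [set y | `|F y| == n%:R]).
  apply: bigcup_measurable => n _; rewrite -[X in measurable X]setTI.
  apply: (measurable_fun_eqr _ (measurable_cst (n%:R : R)) measurableT) => //.
  exact: measurableT_comp.
have E y n : (`|F y| == n%:R) = (`|Num.floor (y * m%:R)|%N == n).
  by rewrite /F -intr_norm -abszE eqr_nat.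
apply/seteqP; split => [y /= Yy|y [n /= Yn]].
  by exists `|Num.floor (y * m%:R)|%N => //=; rewrite E.
by rewrite E => /eqP yn; rewrite /stepf yn.
Qed.

Lemma stepf_bounded m l : exists C : R, forall y, `|stepf m l y| <= C.
Proof.
exists (\sum_(q <- l) `|ratr q|) => y; rewrite /stepf.
elim: l `|Num.floor _|%N => [|q l IH] [|n] /=; rewrite ?big_nil ?big_cons.
- by rewrite rmorph0 normr0.
- by rewrite rmorph0 normr0.
- by rewrite lerDl sumr_ge0.
- by rewrite (le_trans (IH n))// lerDr.
Qed.

Lemma stepf_approx (g : R -> R) eps : continuous g -> 0 < eps ->
  exists m l, forall y, unit_itv y -> `|g y - stepf m l y| <= eps.
Proof.
move=> cg eps0; have e2 : 0 < eps / 2 by rewrite divr_gt0.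
have [m hm] := unif_continuous_unit_itv cg e2.
have /choice[q hq] : forall i : nat, exists q : rat,
    `|g (i%:R / m.+1%:R) - ratr q| <= eps / 2.
  move=> i; set z := g _.
  have : z - eps / 2 < z + eps / 2 by lra.
  move=> /rat_in_itvoo[q]; rewrite in_itv /= => /andP[h1 h2]; exists q.
  by rewrite ler_norml; apply/andP; split; lra.
(* The unit interval has [m.+1] cells; the extra entry serves the endpoint [y = 1]. *)
exists m.+1, (mkseq q m.+2) => y Iy.
have := Iy; rewrite /unit_itv /= in_itv /= => /andP[y0 y1].
have m0 : 0 < m.+1%:R :> R by rewrite ltr0n.
have f0 : 0 <= Num.floor (y * m.+1%:R) by rewrite floor_ge0 mulr_ge0.
rewrite /stepf; set i := `|_|%N.
have iE : i%:R = (Num.floor (y * m.+1%:R))%:~R :> R.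
  by rewrite /i natr_absz ger0_norm.
have /andP[i1 i2] := floor_itv (y * m.+1%:R); rewrite intrD1 -iE in i1 i2.
have im : (i <= m.+1)%N.
  by rewrite -(ler_nat R) (le_trans i1)// ler_piMl.
rewrite nth_mkseq ?ltnS//.
have Ii : unit_itv (i%:R / m.+1%:R : R).
  rewrite /unit_itv /= in_itv /= divr_ge0//= ler_pdivrMr// mul1r ler_nat//.
have yi : `|y - i%:R / m.+1%:R| <= m.+1%:R^-1.
  rewrite ger0_norm; last by rewrite subr_ge0 ler_pdivrMr.
  by rewrite lerBlDr -[X in X + _]mul1r -mulrDl ler_pdivlMr// addrC ltW.
have h1 := hm _ _ Iy Ii yi; have h2 := hq i.
rewrite (_ : g y - _ = (g y - g (i%:R / m.+1%:R)) + (g (i%:R / m.+1%:R) - ratr (q i))); last by ring.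
by apply: (le_trans (ler_normD _ _)); lra.
Qed.

(** Every section [W x] is within [eps] of one of countably many step functions. Were each of them
    close only for a null set of [x], the whole space would be null. *)
Lemma degkernel_separable (d : R) (W : R -> R -> R) : degkernel P d W ->
  kseparable P W.
Proof.
move=> kW eps eps0.
have approx x : exists m l, \int[P]_y `|W x y - stepf m l y| <= eps.
  have e2 : 0 < eps / 2 by rewrite divr_gt0.
  have mI := @unit_itv_measurable R.
  have mWx : measurable_fun setT (W x : T -> R) by exact: (kernel_section kW).
  have lebI : leb unit_itv = 1%E.
    by rewrite /unit_itv lebesgue_measure_itv/= lte_fin ltr01 oppr0 adde0.
  have lebIy : (leb unit_itv < +oo)%E by rewrite lebI ltry.
  have LW : leb.-integrable unit_itv (EFin \o (W x)).
    apply/integrableP; split.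
      by apply/measurable_EFinP; exact: measurable_funS mWx.
    by rewrite integral_uleb; have /integrableP[] := kernel_L1 kW x.
  have [g_ [cg_ Lg_ cv]] := approximation_continuous_integrable mI lebIy LW.
  have [n hn] : exists n, (\int[leb]_(z in unit_itv) `|(W x z - g_ n z)%:E| <= (eps / 2)%:E)%E.
    apply: contrapT => hn; have : ((eps / 2)%:E <= 0)%E.
      apply: (cvge_to_ge cv); apply: nearW => n.
      by apply/ltW; rewrite ltNge; apply/negP => h; apply: hn; exists n.
    by rewrite lee_fin leNgt e2.
  have [m [l hl]] := stepf_approx (cg_ n) e2.
  exists m, l; rewrite -lee_fin.
  have mst := measurable_stepf m l; have [C hC] := stepf_bounded m l.
  have mgn : measurable_fun setT (g_ n : T -> R) by exact: continuous_measurable_fun.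
  rewrite EFin_Rint; last first.
    by apply/L1norm/L1B; [exact: (kernel_L1 kW)|exact: (L1_bounded P mst hC)].
  rewrite -integral_uleb.
  apply: (@le_trans _ _ (\int[leb]_(y in unit_itv)
      (`|(W x y - g_ n y)%:E| + (eps / 2)%:E))%E).
    apply: ge0_le_integral => //.
    - apply/measurable_EFinP/measurableT_comp => //.
      by apply: measurable_funB; [exact: measurable_funS mWx|exact: measurable_funS mst].
    - apply: emeasurable_funD => //; apply: measurableT_comp => //.
      apply/measurable_EFinP/measurable_funB;
        [exact: measurable_funS mWx|exact: measurable_funS mgn].
    - move=> y Iy; rewrite -EFinD lee_fin.
      rewrite (_ : W x y - stepf m l y = (W x y - g_ n y) + (g_ n y - stepf m l y)); last by ring.
      by rewrite (le_trans (ler_normD _ _))// lerD2l hl.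
  rewrite ge0_integralD//; last 2 first.
  - apply: measurableT_comp => //; apply/measurable_EFinP/measurable_funB;
        [exact: measurable_funS mWx|exact: measurable_funS mgn].
  - by move=> y _; rewrite lee_fin ltW.
  have -> : (\int[leb]_(y in unit_itv) (eps / 2)%:E = (eps / 2)%:E)%E.
    by rewrite integral_cst// -[RHS]mule1; congr (_ * _)%E.
  rewrite [X in (_ <= X%:E)%E](splitr eps) EFinD.
  exact: leeD2r.
apply: contrapT => nsep.
have : P.-negligible [set: T].
  pose F n : set T := if unpickle n is Some ml
    then [set x | \int[P]_y `|W x y - stepf (ml : nat * seq rat).1 ml.2 y| <= eps]
    else set0.
  apply: (@negligibleS _ _ _ P (\bigcup_n F n)).
    move=> x _; have [m [l h]] := approx x.
    by exists (pickle (m, l)) => //; rewrite /F pickleK.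
  apply: negligible_bigcup => n; rewrite /F.
  case: unpickle => [[m l]|]; last exact: negligible_set0.
  apply: contrapT => nn; apply: nsep; exists (stepf m l); split => //.
    exact: measurable_stepf.
  exact: stepf_bounded.
move=> /(measure_negligible measurableT) P0.
have P1 : P setT = 1%E by exact: probability_setT.
by have := etrans (esym P1) P0 => /eqP; rewrite onee_eq0.
Qed.

End step_functions.

(** * Transfer from graphons to their kernels *)

Section transfer.
Context {R : realType}.
Local Notation leb := (@lebesgue_measure R).
Local Notation leb2 := (@lebesgue_measure R \x @lebesgue_measure R)%E.
Local Notation T := (measurableTypeR R).
Local Notation P := (@uleb R).
Local Notation L1 f := (P.-integrable setT (EFin \o (f : T -> R))).

(** Equality a.e. in iterated form, ready for comparing the integrals over [y] at almost every
    [x]. *)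
Definition kae (W W0 : R -> R -> R) : Prop :=
  {ae P, forall x, {ae P, forall y, W x y = W0 x y}}.

Lemma lebesgue_set_measurable (A : set R) : measurable (A : set T) -> lebesgue_set A.
Proof.
move=> mA; exists A => //; exists set0; last by rewrite setU0.
exact: negligible_set0.
Qed.

(** A set splitting [W0] also splits [W] inside the unit interval. To pass from iterated null sets
    to a null set of the product, a Borel set is needed: it is [Z], where the Borel version [g] is
    nonzero. *)
Lemma graphon_kconnected (W W0 : R -> R -> R) : is_graphon W ->
  graphon_connected W -> kae W W0 -> kconnected P W0.
Proof.
move=> gW cW WW0 A mA hA; apply: contrapT => /not_orP[nA nC]; apply: cW.
have [g bg] := graphon_borel_version gW.
have sg := borel_version_sections gW bg.
have [mg _ [N [mN N0 hN]]] := bg.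
have mI := @unit_itv_measurable R.
pose B1 : set T := unit_itv `&` A; pose A1 : set T := unit_itv `&` ~` A.
have mA1 : measurable A1 by apply: measurableI => //; exact: measurableC.
have mB1 : measurable B1 by exact: measurableI.
exists A1, B1; split.
- exact: lebesgue_set_measurable.
- exact: lebesgue_set_measurable.
- by rewrite -setIUr setUC setUv setIT.
- by rewrite setIACA setICl setI0.
split.
- rewrite lt0e measure_ge0 andbT; apply/eqP => h; apply: nC.
  by rewrite -h /= /unit_leb /mrestr setIC.
- rewrite lt0e measure_ge0 andbT; apply/eqP => h; apply: nA.
  by rewrite -h /= /unit_leb /mrestr setIC.
pose Z : set (T * T) := (A1 `*` B1) `&` [set z | g z != 0].
have mZ : measurable Z.
  apply: measurableI; first exact: measurableX.
  rewrite -[X in measurable X]setTI.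
  have := measurable_fun_eqr mg (measurable_cst (0 : R)) measurableT.
  by move=> /(_ [set false] Logic.I); congr (measurable (_ `&` _));
    apply/seteqP; split => z /=; case: (g z == 0).
have Z0 : leb2 Z = 0%E.
  apply/prod_null_xsection => //.
  have H : {ae P, forall x, ~ A x -> {ae P, forall y, A y -> g (x, y) = 0}}.
    apply: (ae_imply2 _ (ae_imply2 (fun x a b => conj a b) sg WW0) hA).
    move=> x [gx wx] hx nAx.
    have := ae_imply2 (fun y a b => conj a b) gx wx.
    move=> h; apply: (ae_imply2 _ h (hx nAx)) => y [[gxy _] wxy] h0 Ay.
    by rewrite gxy wxy h0.
  have /ae_uleb H' := H.
  apply: (ae_imply _ H') => x hx.
  apply: measure_negligible; first exact: measurable_xsection.
  have [[Ix nAx]|nA1] := pselect (A1 x); last first.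
    rewrite (_ : xsection Z x = set0); first exact: negligible_set0.
    by rewrite -subset0 => y; rewrite /xsection /= inE => -[[/= ? _] _].
  have /ae_uleb [M [mM M0 hM]] := hx Ix nAx.
  exists M; split => // y; rewrite /xsection /= inE => -[[_ [/= Iy Ay]] /= /eqP gxy].
  by apply: hM => /= /(_ Iy Ay).
exists (Z `|` N); split; first exact: measurableU.
  exact: null_set_setU.
move=> z /= /not_implyP[zAB Wz]; have [gz|gz] := eqVneq (g z) 0; last by left; split.
right; apply: hN => /= h; apply: Wz.
by rewrite -h ?gz//; case: zAB => -[? _] [? _].
Qed.

Lemma cut_dist_kcut (d delta : R) (W W' W0 W0' : R -> R -> R) :
  kae W W0 -> kae W' W0' -> degkernel P d W0 -> degkernel P d W0' ->
  (cut_dist W W' < delta%:E)%E -> kcut P W0 W0' delta.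
Proof.
move=> WW0 WW0' kW kW' cut A B mA mB.
have mI := @unit_itv_measurable R.
have LB : L1 (\1_B) by exact: L1_indic.
have B0 x : 0 <= (\1_B x : R) by rewrite indicE.
have Lk : L1 (fun x => kop P W0 \1_B x - kop P W0' \1_B x).
  by apply: L1B; [apply: (kop_L1 kW)|apply: (kop_L1 kW')].
rewrite -lee_fin; apply: le_trans (ltW cut).
apply: ereal_sup_ubound; exists (unit_itv `&` A), (unit_itv `&` B); split.
- exact/lebesgue_set_measurable/measurableI.
- exact/lebesgue_set_measurable/measurableI.
- by move=> x [].
- by move=> x [].
rewrite -abse_EFin EFin_Rint; last first.
  rewrite (_ : (fun _ => _) = (fun x => (kop P W0 \1_B x - kop P W0' \1_B x) * \1_A x)).
    apply: (L1M Lk); first exact: measurable_indic.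
    by move=> x; rewrite indicE; case: (_ \in _); rewrite ?normr1 ?normr0.
  by apply/funext => x; rewrite mulrC.
congr (`| _ |)%E; rewrite integral_mkcondr integral_uleb.
apply: integral_ae_eq_gen; apply: (ae_imply2 _ WW0 WW0') => x hx hx'.
rewrite patchE indicE; case: ifP => xA; rewrite ?mul1r ?mul0r//.
rewrite integral_mkcondr integral_uleb EFinB (EFin_kop kW)// (EFin_kop kW')//.
rewrite -integralB_EFin//; [|exact: (kopL1 kW)|exact: (kopL1 kW')].
apply: integral_ae_eq_gen; apply: (ae_imply2 _ hx hx') => y h h'.
rewrite patchE indicE; case: ifP => yB; first by rewrite !mul1r h h' EFinB.
by rewrite !mul0r subee.
Qed.

Lemma chip_configuration_L1 (sigma : R -> R) : chip_configuration sigma ->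
  exists sigma0 : R -> R, [/\ L1 sigma0, forall x, 0 <= sigma0 x &
    {ae P, forall x, sigma x = sigma0 x}].
Proof.
move=> [ms ns s0]; have [g [mg g0 gs]] := completed_borel_version ms.
have E : {ae P, forall x, sigma x = g x}.
  apply/ae_uleb; apply: (ae_imply2 _ gs s0) => x h1 h2 Ix.
  by rewrite h1// max_l// h2.
exists g; split => //; apply/integrableP; split; first exact/measurable_EFinP.
move: ns; rewrite /norm1 integral_uleb.
rewrite (@integral_ae_eq_gen _ _ _ P _ (fun x => `|(g x)%:E|%E))//.
by apply: (ae_imply _ E) => x ->.
Qed.

Lemma norm1_dist (sigma sigma' sigma0 sigma0' : R -> R) (delta : R) :
  {ae P, forall x, sigma x = sigma0 x} -> {ae P, forall x, sigma' x = sigma0' x} ->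
  L1 sigma0 -> L1 sigma0' ->
  (norm1 (fun x => (sigma x - sigma' x)%R) < delta%:E)%E ->
  \int[P]_x `|sigma0 x - sigma0' x| <= delta.
Proof.
move=> s s' Ls Ls'; rewrite /norm1 integral_uleb => h.
rewrite -lee_fin EFin_Rint; last by exact/L1norm/L1B.
apply: le_trans (ltW h); rewrite le_eqVlt; apply/orP; left; apply/eqP.
by apply: integral_ae_eq_gen; apply: (ae_imply2 _ s s') => x -> ->.
Qed.

Lemma ae_forall_nat (Q : nat -> R -> Prop) :
  (forall n, {ae P, forall x, Q n x}) -> {ae P, forall x, forall n, Q n x}.
Proof.
move=> h; apply: (@negligibleS _ _ _ P (\bigcup_n ~` [set x | Q n x])).
  move=> x /= /existsNP[n nQ]; by exists n.
by apply: negligible_bigcup => n; exact: h.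
Qed.

Lemma ae_exists (Q : R -> Prop) : {ae P, forall x, Q x} -> exists x, Q x.
Proof.
move=> [N [mN N0 hN]]; apply: contrapT => nQ.
have P1 : P setT = 1%E by exact: probability_setT.
have NT : N = setT by rewrite -subTset => x _; apply: hN => /= q; apply: nQ; exists x.
by move: N0; rewrite NT => /(etrans (esym P1)) /eqP; rewrite onee_eq0.
Qed.

Section odometer_transfer.
Variables (d : R) (W W0 : R -> R -> R) (sigma sigma0 : R -> R).
Hypothesis d0 : 0 < d.
Hypothesis kW : degkernel P d W0.
Hypothesis WW0 : kae W W0.
Hypothesis Ls : L1 sigma0.
Hypothesis s0 : forall x, 0 <= sigma0 x.
Hypothesis ss0 : {ae P, forall x, sigma x = sigma0 x}.
Local Notation u_ := (kodo P W0 sigma0).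
Local Notation D := (kdeg P W0).

Let Lu n : L1 (u_ n). Proof. exact: (kodo_L1 d0 kW). Qed.

Lemma deg_ae : {ae P, forall x, deg W x = D x}.
Proof.
by apply: (ae_imply _ WW0) => x hx; rewrite deg_uleb /kdeg; exact: Rintegral_ae_eq_gen.
Qed.

(** Dividing the configuration by [D x] subtracts the integer [u_ n x] inside the floor, which
    leaves the increment of the odometer. *)
Let firing_step n :
  {ae P, forall x, iter n (update W) sigma x = sigma0 x + kop P W0 (u_ n) x - D x * u_ n x} ->
  {ae P, forall x, firing W (iter n (update W) sigma) x = u_ n.+1 x - u_ n x}.
Proof.
move=> h; apply: (ae_imply2 _ h deg_ae) => x hx dx.
have D0 := kdeg_gt0 d0 kW x.
rewrite /firing dx D0 hx mulrBl [D x * _]mulrC mulfK ?gt_eqF//.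
have uz := kodo_int P W0 sigma0 n x.
by rewrite floorDrz ?rpredN// intrD floorN// intrN (floorK uz).
Qed.

Lemma iter_update_ae n :
  {ae P, forall x, iter n (update W) sigma x = sigma0 x + kop P W0 (u_ n) x - D x * u_ n x}.
Proof.
elim: n => [|n IH].
  by apply: (ae_imply _ ss0) => x /= ->; rewrite (kop_cst kW) mul0r mulr0 addr0 subr0.
have fS := firing_step IH.
have H : {ae P, forall x, \int[leb]_(y in unit_itv)
    (firing W (iter n (update W) sigma) y * W x y) =
    kop P W0 (u_ n.+1) x - kop P W0 (u_ n) x}.
  apply: (ae_imply _ WW0) => x hx; rewrite Rintegral_uleb -(kopB kW)//.
  by apply: Rintegral_ae_eq_gen; apply: (ae_imply2 _ fS hx) => y -> ->.
apply: (ae_imply2 _ (ae_imply2 (fun x a b => conj a b) IH fS)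
  (ae_imply2 (fun x a b => conj a b) deg_ae H)) => x [h1 h2] [h3 h4].
rewrite iterS /update h4 h3 h2 -/(iter n (update W) sigma) h1; ring.
Qed.

Lemma odometer_ae : {ae P, forall x, forall n, odometer W n sigma x = u_ n x}.
Proof.
have F : {ae P, forall x, forall n,
    firing W (iter n (update W) sigma) x = u_ n.+1 x - u_ n x}.
  by apply: ae_forall_nat => n; apply: firing_step; exact: iter_update_ae.
apply: (ae_imply _ F) => x hx; elim=> [|n IH]; first by rewrite /odometer big_ord0.
by rewrite /odometer big_ord_recr /= -/(odometer W n sigma x) IH hx addrC subrK.
Qed.

(** Two limits holding a.e. hold at a common point, so the value picked by [xget] is unique. *)
Lemma activityE (a : R) : (forall x, u_ n x / n%:R @[n --> \oo] --> a) ->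
  activity W sigma = a.
Proof.
move=> ua.
have H : {ae P, forall x, odometer W n sigma x / n%:R @[n --> \oo] --> a}.
  apply: (ae_imply _ odometer_ae) => x hx.
  by rewrite (_ : (fun n => _) = fun n => u_ n x / n%:R); last by apply/funext => n; rewrite hx.
rewrite /activity; apply: xget_unique => [|b]; first by apply/ae_uleb.
move=> /ae_uleb Hb.
have [x [h1 h2]] := ae_exists (ae_imply2 (fun x a b => conj a b) H Hb).
exact: (cvg_unique _ h2 h1).
Qed.

(** The quotient exceeds configuration over degree by the integer [u_ n x]. If it is an integer, the
    configuration is an integer multiple of the degree, and a natural one because configurations are
    non-negative. *)
Lemma smooth_pair_uleb : smooth_pair W sigma -> forall n, P.-negligible
  [set x | (sigma0 x + kop P W0 (u_ n) x) / D x \is a Num.int].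
Proof.
move=> sm n; have [M [mM M0 hM]] := sm n.
have nM : {ae P, forall x, ~ (exists k : nat, iter n (update W) sigma x = k%:R * deg W x)}.
  by apply/ae_uleb; exists M; split => // x /= /not_implyP[Ix /contrapT hx]; apply: hM.
have [N [mN N0 hN]] := ae_imply2 (fun x a b => conj a b) nM
  (ae_imply2 (fun x a b => conj a b) deg_ae (iter_update_ae n)).
exists N; split => // x /= xz; apply: hN => /= -[h1 [h2 h3]]; apply: h1.
have D0 := kdeg_gt0 d0 kW x.
pose z := (sigma0 x + kop P W0 (u_ n) x) / D x - u_ n x.
have zz : z \is a Num.int by rewrite rpredB// kodo_int.
have zE : z * D x = sigma0 x + kop P W0 (u_ n) x - D x * u_ n x.
  by rewrite /z mulrBl divfK ?gt_eqF// [u_ n x * _]mulrC.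
have z0 : 0 <= z.
  rewrite -(pmulr_lge0 _ D0) zE; exact: (kodo_config_ge0 d0 kW).
exists `|Num.floor z|%N; rewrite h2 h3 -zE; congr (_ * _).
by rewrite natr_absz ger0_norm ?floor_ge0// floorK.
Qed.

End odometer_transfer.

End transfer.

Theorem theorem5p2 (R : realType) (d : R) (W : R -> R -> R) (sigma : R -> R) :
  0 < d ->
  is_graphon W -> graphon_connected W -> (d%:E <= mindeg W)%E ->
  chip_configuration sigma -> smooth_pair W sigma ->
  forall eps : R, 0 < eps ->
  exists2 delta : R, 0 < delta &
    forall (W' : R -> R -> R) (sigma' : R -> R),
      is_graphon W' -> graphon_connected W' -> (d%:E <= mindeg W')%E ->
      (cut_dist W W' < delta%:E)%E ->
      chip_configuration sigma' ->
      (norm1 (fun x => (sigma x - sigma' x)%R) < delta%:E)%E ->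
      `|activity W sigma - activity W' sigma'| < eps.
Proof.
move=> d0 gW cW dW cs sm eps eps0.
have [W0 kW WW0] := graphon_degkernel d0 gW dW.
have [sigma0 [Ls s0 ss0]] := chip_configuration_L1 cs.
have [a ua /(_ eps eps0)[delta delta0 H]] := kactivity_continuous d0 kW
  (graphon_kconnected gW cW WW0) (degkernel_separable kW) Ls s0
  (smooth_pair_uleb d0 kW WW0 Ls s0 ss0 sm).
exists delta => // W' sigma' gW' cW' dW' cut cs' ns.
have [W0' kW' WW0'] := graphon_degkernel d0 gW' dW'.
have [sigma0' [Ls' s0' ss0']] := chip_configuration_L1 cs'.
have [a' ua' aa'] := H W0' sigma0' kW' (graphon_kconnected gW' cW' WW0')
  (degkernel_separable kW') (cut_dist_kcut WW0 WW0' kW kW' cut) Ls' s0'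
  (norm1_dist ss0 ss0' Ls Ls' ns).
by rewrite (activityE d0 kW WW0 Ls s0 ss0 ua) (activityE d0 kW' WW0' Ls' s0' ss0' ua').
Qed.
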